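(* Let $d\geq 2$ and consider on $\mathbb{T}^d\times[0,\infty)$ the active scalar equation $$\partial_t\theta+\boldsymbol{u}\cdot\nabla\theta=0,\qquad \nabla\cdot\boldsymbol{u}=0,\qquad \boldsymbol{u}=\boldsymbol{M}\theta,$$ where $\boldsymbol{M}$ is the Fourier multiplier operator with symbol $\boldsymbol{m}=(m_1,\dots,m_d):\mathbb{Z}^d\to\mathbb{R}^d$. Writing $\boldsymbol{k}=(\boldsymbol{k}',k_d)$ with $\boldsymbol{k}'\in\mathbb{Z}^{d-1}$, assume that for some fixed positive integer $a$: (1) $\boldsymbol{m}(\boldsymbol{0}',a)=0$ (so $\bar\theta=\sin(ax_d)$ is a steady state with velocity $0$); (2) $m_d(\boldsymbol{k})$ is a real positive rational function which is even in $\boldsymbol{k}$; (3) $m_d(\boldsymbol{k}',na)\to\infty$ as $|\boldsymbol{k}'|\to\infty$, for each fixed $n\in\mathbb{N}$; (4) $m_d(\boldsymbol{k}',na)\to 0$ as $n\to\infty$, for each fixed $\boldsymbol{k}'\in\mathbb{Z}^{d-1}$; (5) $m_d(\boldsymbol{k}',(n+1)a)<m_d(\boldsymbol{k}',na)$ for all $n\in\mathbb{N}$ and each fixed $\boldsymbol{k}'$; (6) $|\boldsymbol{m}(\boldsymbol{k})|\leq C(1+|\boldsymbol{k}|)^{r_0}$ for all $\boldsymbol{k}\in\mathbb{Z}^d$, for some $r_0\geq0$, $C>0$. Then this equation is locally Lipschitz $(H^r,H^s)$ ill-posed for any $r>\max\{2,r_0\}$ and $s\geq r+1$, i.e. it is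 not locally Lipschitz $(H^r,H^s)$ well-posed in the sense defined in the context.
   Context: Definition: let $Y\subset X\subset L^2$ be Banach spaces. The initial value problem for the equation is called locally Lipschitz $(X,Y)$ well-posed if there exist continuous functions $T:[0,\infty)^2\to(0,\infty)$, non-increasing in both variables, and $K:[0,\infty)^2\to(0,\infty)$, non-decreasing in both variables, such that for every pair of initial data $\theta^{(1)}_0,\theta^{(2)}_0\in Y$ there exist unique solutions $\theta^{(1)},\theta^{(2)}\in L^\infty(0,T;X)$ with these data satisfying $\|\theta^{(1)}(\cdot,t)-\theta^{(2)}(\cdot,t)\|_X\leq K\|\theta^{(1)}_0-\theta^{(2)}_0\|_Y$ for all $t\in[0,T]$, where $T$ and $K$ are evaluated at $(\|\theta^{(1)}_0\|_Y,\|\theta^{(2)}_0\|_Y)$.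
   Formalization: Positivity in (2) and the strict decrease in (5) are required only for k' ≠ 0 (at k' = 0 they contradict (1) and (4)); the modes n in (3) and (5) are n ≥ 1; m_d is required to equal a rational function only for k ≠ 0. *)

(* Defs.v *)
From HB Require Import structures.
From mathcomp Require Import all_boot all_order all_algebra.
From mathcomp Require Import all_classical all_reals all_analysis.
From mathcomp Require Import complex.
Set Implicit Arguments. Unset Strict Implicit. Unset Printing Implicit Defensive.
Import Order.TTheory GRing.Theory Num.Theory.
Import numFieldNormedType.Exports.
Local Open Scope classical_set_scope.
Local Open Scope ring_scope.

(* Throughout, the spatial dimension is d = n.+1 (so d >= 2 iff 1 <= n).
   Z^d is 'rV[int]_n.+1; the last coordinate (index ord_max) is k_d and the
   first n coordinates form k' in Z^(d-1).
   A real function theta on T^d = (R/2piZ)^d is represented by its Fourier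
   coefficients theta_hat : Z^d -> C, theta(x) = sum_k theta_hat(k) e^{i k.x}. *)

Section Defs.
Context (R : realType).

Definition Zd (n : nat) := 'rV[int]_n.+1.

Definition ptZ n (k' : 'rV[int]_n) (c : int) : Zd n :=
  \row_(i < n.+1) (if unlift ord_max i is Some j then k' 0 j else c).

Definition normZ m (k : 'rV[int]_m) : R :=
  Num.sqrt (\sum_(i < m) ((k 0 i)%:~R : R) ^+ 2).

Definition normRv m (v : 'rV[R]_m) : R :=
  Num.sqrt (\sum_(i < m) (v 0 i) ^+ 2).

Definition dotRZ m (v : 'rV[R]_m) (k : 'rV[int]_m) : R :=
  \sum_(i < m) v 0 i * (k 0 i)%:~R.

Definition polyZ n (N : nat) (c : {ffun 'I_n.+1 -> 'I_N} -> R) (k : Zd n) : R :=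
  \sum_(e : {ffun 'I_n.+1 -> 'I_N}) c e * \prod_(i < n.+1) ((k 0 i)%:~R : R) ^+ e i.

(* f : Z^d -> R is (the restriction of) a real rational function P/Q
   (with the value at k = 0 left to convention) *)
Definition rational_fun n (f : Zd n -> R) : Prop :=
  exists (N : nat) (P Q : {ffun 'I_n.+1 -> 'I_N} -> R),
    forall k : Zd n, k != 0 -> polyZ Q k != 0 /\ f k = polyZ P k / polyZ Q k.

Definition coef n := Zd n -> R[i].

Definition sqmodC (z : R[i]) : R := (complex.Re z) ^+ 2 + (complex.Im z) ^+ 2.

(* real-valuedness of the function: hermitian symmetry of its coefficients *)
Definition hermitian n (th : coef n) : Prop :=
  forall k, th (- k) = conjc (th k).

Definition Hs_sq n (s : R) (th : coef n) : \bar R :=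
  \esum_(k in [set: Zd n]) ((powR (1 + normZ k ^+ 2) s * sqmodC (th k))%:E).

Definition in_Hs n (s : R) (th : coef n) : Prop :=
  hermitian th /\ (Hs_sq s th < +oo)%E.

Definition Hs_norm n (s : R) (th : coef n) : R := Num.sqrt (fine (Hs_sq s th)).

Definition rsum (T : choiceType) (f : T -> R) : R :=
  fine (\esum_(x in [set: T]) (Num.max (f x) 0)%:E)
  - fine (\esum_(x in [set: T]) (Num.max (- f x) 0)%:E).

Definition csum (T : choiceType) (f : T -> R[i]) : R[i] :=
  Complex (rsum (fun x => complex.Re (f x))) (rsum (fun x => complex.Im (f x))).

Definition csummable (T : choiceType) (f : T -> R[i]) : Prop :=
  summable [set: T] (fun x => (Num.sqrt (sqmodC (f x)))%:E).

(* the j-th term of the k-th Fourier coefficient of u . grad theta, u = M theta: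
   (u . grad theta)^(k) = sum_j i (m(j) . (k-j)) theta_hat(j) theta_hat(k-j) *)
Definition nl_term n (m : Zd n -> 'rV[R]_n.+1) (th : coef n) (k : Zd n) :
    Zd n -> R[i] :=
  fun j => Complex 0 (dotRZ (m j) (k - j)) * th j * th (k - j).

Definition nl n (m : Zd n -> 'rV[R]_n.+1) (th : coef n) (k : Zd n) : R[i] :=
  csum (nl_term m th k).

Definition cintegrable (t : R) (g : R -> R[i]) : Prop :=
  (@lebesgue_measure R).-integrable `[0, t] (EFin \o (fun x => complex.Re (g x)))
  /\ (@lebesgue_measure R).-integrable `[0, t] (EFin \o (fun x => complex.Im (g x))).

Definition cintegral (t : R) (g : R -> R[i]) : R[i] :=
  Complex (Rintegral (@lebesgue_measure R) `[0, t] (fun x => complex.Re (g x)))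
          (Rintegral (@lebesgue_measure R) `[0, t] (fun x => complex.Im (g x))).

(* theta is a solution on [0,T] of  d_t theta + u.grad theta = 0, u = M theta,
   with initial datum th0, lying in L^oo(0,T;H^r): for every Fourier mode k,
   theta_hat(k,t) = th0(k) - int_0^t (u.grad theta)^(k,s) ds. *)
Definition is_solution n (m : Zd n -> 'rV[R]_n.+1) (r T : R)
    (th0 : coef n) (th : R -> coef n) : Prop :=
  [/\ th 0 = th0,
      (forall t, 0 <= t <= T -> in_Hs r (th t)),
      (exists B : R, forall t, 0 <= t <= T -> Hs_norm r (th t) <= B),
      (forall t k, 0 <= t <= T -> csummable (nl_term m (th t) k)) &
      (forall t k, 0 <= t <= T ->
         cintegrable t (fun x => nl m (th x) k) /\
         th t k = th0 k - cintegral t (fun x => nl m (th x) k))].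

Definition unique_solution n (m : Zd n -> 'rV[R]_n.+1) (r T : R)
    (th0 : coef n) (th : R -> coef n) : Prop :=
  is_solution m r T th0 th /\
  forall th', is_solution m r T th0 th' -> forall t, 0 <= t <= T -> th' t = th t.

Definition quadrant : set (R * R) := [set p | 0 <= p.1 /\ 0 <= p.2].

Definition lip_wellposed n (m : Zd n -> 'rV[R]_n.+1) (r s : R) : Prop :=
  exists Tf Kf : R -> R -> R,
  [/\ {within quadrant, continuous (fun p : R * R => Tf p.1 p.2)},
      {within quadrant, continuous (fun p : R * R => Kf p.1 p.2)},
      (forall x y, 0 <= x -> 0 <= y -> 0 < Tf x y /\ 0 < Kf x y),
      (forall x x' y, 0 <= x -> x <= x' -> 0 <= y ->
         Tf x' y <= Tf x y /\ Tf y x' <= Tf y x /\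
         Kf x y <= Kf x' y /\ Kf y x <= Kf y x') &
      (forall th1 th2 : coef n, in_Hs s th1 -> in_Hs s th2 ->
         let T := Tf (Hs_norm s th1) (Hs_norm s th2) in
         let K := Kf (Hs_norm s th1) (Hs_norm s th2) in
         exists u1 u2 : R -> coef n,
           [/\ unique_solution m r T th1 u1,
               unique_solution m r T th2 u2 &
               forall t, 0 <= t <= T ->
                 Hs_norm r (fun k => u1 t k - u2 t k)
                   <= K * Hs_norm s (fun k => th1 k - th2 k)])].

End Defs.

(* Main.v *)
Require Import Defs.
From HB Require Import structures.
From mathcomp Require Import all_boot all_order all_algebra.
From mathcomp Require Import all_classical all_reals all_analysis.
From mathcomp Require Import complex.
From mathcomp Require Import ring lra.
Import Order.TTheory GRing.Theory Num.Theory.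
Import numFieldNormedType.Exports.
Local Open Scope classical_set_scope.
Local Open Scope ring_scope.

(* The steady state -sin(a x_d) is perturbed by eps times the real wave of
   frequency (k', a).  Local Lipschitz well-posedness bounds the perturbation d
   in H^r by O(eps) on a time interval independent of k' and eps, and then the
   quadratic term of the equation for d is O(eps^2) uniformly in the frequency.
   Restricted to the modes (k', i a), i in Z, the linearization is therefore an
   infinite tridiagonal system with entries (a/2) m_d(k', i a), bounded for fixed
   k', and d follows its Taylor series up to a Picard remainder and O(eps^2).
   As the entries are nonnegative (this is why -sin is used rather than sin), the
   walks 1 -> 2 -> 1 -> ... -> 1 alone make the mode i = 1 at least
   eps T^(2q) (a^2 m_d(k',a) m_d(k',2a) / 4)^q / (2q)! for every q, up to these
   errors.
   Along an axis, a rational function that tends to infinity grows at least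
   linearly, so this quantity is of order |k'|^(2q), whereas the Lipschitz bound
   only allows eps |k'|^s up to a constant: contradiction for large q. *)

Set Implicit Arguments.
Unset Strict Implicit.

(** * Unconditional real sums as differences of positive and negative parts *)

Section UnconditionalSums.
Context {R : realType} {T : choiceType}.
Implicit Types f g : T -> R.

Definition rsummable f := summable [set: T] (EFin \o f).

Lemma rsummableP f g B : (forall x, `|f x| <= g x) ->
  (\esum_(x in [set: T]) (g x)%:E <= B%:E)%E -> rsummable f.
Proof.
move=> fg gB; apply: le_lt_trans (ltry B); apply: le_trans gB.
by apply: le_esum => x _ /=; rewrite lee_fin.
Qed.

Lemma rsummable_pos f : rsummable f ->
  \esum_(x in [set: T]) (Num.max (f x) 0)%:E \is a fin_num.
Proof.
move=> sf; rewrite ge0_fin_numE; last first.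
  by apply: esum_ge0 => x _; rewrite lee_fin le_max lexx orbT.
apply: le_lt_trans sf; apply: le_esum => x _ /=.
by rewrite lee_fin ge_max normr_ge0 ler_norm.
Qed.

Lemma rsummableN f : rsummable f -> rsummable (fun x => - f x).
Proof.
move=> sf; rewrite /rsummable /summable; under eq_esum do rewrite /= normrN.
exact: sf.
Qed.

Lemma rsummableD f g : rsummable f -> rsummable g ->
  rsummable (fun x => f x + g x).
Proof. exact: summableD. Qed.

(** Pointwise (f + g)^+ + f^- + g^- = (f + g)^- + f^+ + g^+. Both sides are nonnegative, so they sum
    additively in the extended reals, and finiteness allows the terms to be rearranged. *)
Lemma rsumD f g : rsummable f -> rsummable g ->
  rsum (fun x => f x + g x) = rsum f + rsum g.
Proof.
move=> sf sg; have sfg := rsummableD sf sg.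
have sNf := rsummableN sf; have sNg := rsummableN sg; have sNfg := rsummableN sfg.
set S := fun h : T -> R => \esum_(x in [set: T]) (Num.max (h x) 0)%:E.
have S0 h x : setT x -> (0 <= (Num.max (h x) 0)%:E :> \bar R)%E.
  by rewrite lee_fin le_max lexx orbT.
have key : (S (fun x => f x + g x)%R + S (fun x => - f x)%R + S (fun x => - g x)%R
    = S (fun x => - (f x + g x))%R + S f + S g)%E.
  rewrite /S -!esumD//; try by move=> x Tx; rewrite ?adde_ge0 ?S0.
  apply: eq_esum => x _; rewrite -!EFinD; congr EFin.
  have pm (z : R) : Num.max z 0 - Num.max (- z) 0 = z.
    by rewrite !maxEle; case: (leP z 0); case: (leP (- z) 0) => *; lra.
  by move: (pm (f x + g x)) (pm (f x)) (pm (g x)) => /= *; lra.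
have /(congr1 fine) := key.
rewrite !fineD ?fin_numD ?rsummable_pos// => e.
rewrite /rsum -!/(S _); move: e; rewrite -/(S _); lra.
Qed.

(** The positive and the negative sum both lie in [0, B], so their difference is bounded by B and
    not only by 2 B. *)
Lemma rsum_le f g B : (forall x, `|f x| <= g x) ->
  (\esum_(x in [set: T]) (g x)%:E <= B%:E)%E -> `|rsum f| <= B.
Proof.
move=> fg gB; have sf := rsummableP fg gB.
have half h : rsummable h -> (forall x, h x <= g x) ->
    0 <= fine (\esum_(x in [set: T]) (Num.max (h x) 0)%:E) <= B.
  move=> sh hg; rewrite fine_ge0/=; last first.
    by apply: esum_ge0 => x _; rewrite lee_fin le_max lexx orbT.
  rewrite -lee_fin fineK ?rsummable_pos//; apply: le_trans gB.
  apply: le_esum => x _; rewrite lee_fin ge_max hg/=.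
  exact: le_trans (fg x).
have f_le x : f x <= g x by exact: le_trans (ler_norm _) (fg x).
have Nf_le x : - f x <= g x by apply: le_trans (fg x); rewrite -normrN ler_norm.
move: (half _ sf f_le) (half _ (rsummableN sf) Nf_le) => /andP[? ?] /andP[? ?].
rewrite /rsum ler_norml; apply/andP; split; lra.
Qed.

Lemma esum_single (p : T) (c : \bar R) : (0 <= c)%E ->
  (\esum_(x in [set: T]) (if x == p then c else 0) = c)%E.
Proof.
move=> c0; rewrite -[RHS](@esum_set1 _ _ p (fun=> c))// [RHS]esum_mkcond.
by apply: eq_esum => x _; rewrite in_set1.
Qed.

Lemma rsummable_single (p : T) (c : R) :
  rsummable (fun x => if x == p then c else 0).
Proof.
apply: (@rsummableP _ (fun x => if x == p then `|c| else 0) `|c|) => [x|].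
  by case: ifP; rewrite ?normr0.
rewrite (eq_esum (b := fun x => if x == p then `|c|%:E else 0%E)) => [|x _].
  by rewrite esum_single.
by case: ifP.
Qed.

Lemma rsum_single (p : T) (c : R) : rsum (fun x => if x == p then c else 0) = c.
Proof.
have part (z : R) : \esum_(x in [set: T])
    (Num.max (if x == p then z else 0) 0)%:E = (Num.max z 0)%:E.
  rewrite -[RHS](@esum_single p) ?lee_fin ?le_max ?lexx ?orbT//.
  by apply: eq_esum => x _; case: ifP; rewrite // maxxx.
rewrite /rsum part.
have -> : (fun x => (Num.max (- (if x == p then c else 0)) 0)%:E) =
    (fun x => (Num.max (if x == p then - c else 0) 0)%:E) :> (T -> \bar R).
  by apply/funext => x; case: ifP; rewrite ?oppr0.
rewrite part /= !maxEle; case: (leP c 0); case: (leP (- c) 0) => *; lra.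
Qed.

Lemma rsum_single_add (p : T) (c : R) g : rsummable g ->
  rsummable (fun x => (if x == p then c else 0) + g x) /\
  rsum (fun x => (if x == p then c else 0) + g x) = c + rsum g.
Proof.
move=> sg; have s1 := rsummable_single p c; split; first exact: rsummableD.
by rewrite (rsumD s1 sg) rsum_single.
Qed.

End UnconditionalSums.

(** * Picard iteration for infinite tridiagonal systems with bounded entries *)

Section Picard.
Context {R : realType}.
Local Notation mu := (@lebesgue_measure R).

Lemma Rintegral_deriv_poly (p : {poly R}) (t : R) : 0 <= t ->
  mu.-integrable `[0, t] (EFin \o horner p^`()) /\
  Rintegral mu `[0, t] (horner p^`()) = p.[t] - p.[0].
Proof.
move=> t0; split.
  apply: continuous_compact_integrable; first exact: segment_compact.
  by apply: continuous_subspaceT => x; exact: continuous_horner.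
move: t0; rewrite le_eqVlt => /predU1P[<-|t0].
  by rewrite set_itv1 Rintegral_set1 subrr.
rewrite /Rintegral (@continuous_FTC2 _ _ (horner p)) ?fineB//.
- by apply: continuous_subspaceT => x; exact: continuous_horner.
- split.
  + by move=> x _; exact: derivable_horner.
  + by apply: cvg_at_right_filter; exact: continuous_horner.
  + by apply: cvg_at_left_filter; exact: continuous_horner.
- by move=> x _; rewrite -derivE.
Qed.

(** Writing approximant and error bound as derivatives of polynomials turns a Picard step into
    polynomial evaluation. *)
Lemma Rintegral_poly_approx (f : R -> R) (p e : {poly R}) (t : R) : 0 <= t ->
  mu.-integrable `[0, t] (EFin \o f) ->
  (forall x, 0 <= x <= t -> `|f x - p^`().[x]| <= e^`().[x]) ->
  `|Rintegral mu `[0, t] f - (p.[t] - p.[0])| <= e.[t] - e.[0].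
Proof.
move=> t0 intf fpe.
have [intp Ip] := Rintegral_deriv_poly p t0.
have [inte Ie] := Rintegral_deriv_poly e t0.
rewrite -Ip -Ie -RintegralB//.
have intfp : mu.-integrable `[0, t] (EFin \o (fun x => f x - p^`().[x])).
  by apply: (integrableB _ intf intp).
apply: le_trans (le_normr_Rintegral _ intfp) _ => //.
apply: le_Rintegral => //; first exact: (integrable_abse intfp).
Qed.

(** Normalized so that differentiation lowers the index by one and leaves no factor. *)
Definition exp_monom (p : nat) : {poly R} := (p`!%:R)^-1 *: 'X^p.

Lemma deriv_exp_monomS p : (exp_monom p.+1)^`() = exp_monom p.
Proof.
rewrite /exp_monom derivZ derivXn  /= -(scaler_nat _ 'X^p) scalerA; congr (_ *: _).
by rewrite factS natrM invfM mulrAC mulVf ?mul1r// pnatr_eq0.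
Qed.

Lemma deriv_exp_monom0 : (exp_monom 0)^`() = 0.
Proof. by rewrite /exp_monom expr0 derivZ derivC scaler0. Qed.

Lemma horner_exp_monom p x : (exp_monom p).[x] = x ^+ p / p`!%:R.
Proof. by rewrite /exp_monom !hornerE mulrC. Qed.

Lemma exp_monomS0 p : (exp_monom p.+1).[0] = 0.
Proof. by rewrite horner_exp_monom expr0n/= mul0r. Qed.

Variables (al be : int -> R).

Definition tridiag (z : int -> R) (i : int) : R :=
  al i * z (i - 1) + be i * z (i + 1).

(** The first P terms of the series of exp(t A) y0 at site i, where A is [tridiag]. *)
Definition taylor (y0 : int -> R) (P : nat) (i : int) : {poly R} :=
  \sum_(p < P) iter p tridiag y0 i *: exp_monom p.

(** The result of P iterations of e -> integral of (L e + eta), started at the constant B. *)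
Definition remainder (L B eta : R) (P : nat) : {poly R} :=
  (B * L ^+ P) *: exp_monom P + eta *: \sum_(p < P) L ^+ p *: exp_monom p.+1.

Lemma deriv_taylorS y0 P i x :
  (taylor y0 P.+1 i)^`().[x] = tridiag (fun j => (taylor y0 P j).[x]) i.
Proof.
rewrite /taylor raddf_sum big_ord_recl /= derivZ deriv_exp_monom0 scaler0 add0r.
rewrite /tridiag !horner_sum !mulr_sumr -big_split /=; apply: eq_bigr => p _.
rewrite /bump /= add1n derivZ deriv_exp_monomS !hornerZ /= /tridiag.
by rewrite mulrDl !mulrA.
Qed.

Lemma taylor0 y0 P i : (taylor y0 P.+1 i).[0] = y0 i.
Proof.
rewrite /taylor horner_sum big_ord_recl big1 => [|p _].
  by rewrite hornerZ horner_exp_monom expr0 fact0 divr1 mulr1 addr0.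
by rewrite hornerZ /= exp_monomS0 mulr0.
Qed.

Lemma deriv_remainderS L B eta P x :
  (remainder L B eta P.+1)^`().[x] = L * (remainder L B eta P).[x] + eta.
Proof.
have dE c p : (c *: exp_monom p.+1)^`().[x] = c * (exp_monom p).[x].
  by rewrite derivZ deriv_exp_monomS hornerZ.
rewrite /remainder derivD hornerD dE derivZ hornerZ raddf_sum horner_sum.
rewrite big_ord_recl dE (horner_exp_monom 0) expr0 fact0 divr1 mulr1.
have -> : \sum_(p < P) ((L ^+ (lift ord0 p) *: exp_monom (lift ord0 p).+1)^`()).[x]
    = L * (\sum_(p < P) L ^+ p *: exp_monom p.+1).[x].
  rewrite horner_sum mulr_sumr; apply: eq_bigr => p _.
  by rewrite dE /= /bump add1n exprS -mulrA -hornerZ.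
have hE c p : (c *: exp_monom p).[x] = c * (exp_monom p).[x] by rewrite hornerZ.
rewrite hornerD hE (hornerZ _ (\sum_(p < P) _)) -[L ^+ ord0]/1 exprS; ring.
Qed.

Lemma remainderS0 L B eta P : (remainder L B eta P.+1).[0] = 0.
Proof.
rewrite /remainder hornerD hornerZ exp_monomS0 hornerZ horner_sum big1.
  by rewrite !mulr0 addr0.
by move=> p _; rewrite hornerZ exp_monomS0 mulr0.
Qed.

(** Induction on P. The empty Taylor polynomial is 0, with error at most B. A bound by [remainder]
    at P makes the integrands differ by at most L times it plus eta, which is the derivative of
    [remainder] at P + 1. *)
Lemma picard (L B eta T : R) (y : R -> int -> R) (y0 : int -> R)
    (F : int -> R -> R) :
  (forall i, `|al i| + `|be i| <= L) ->
  (forall t i, 0 <= t <= T -> `|y t i| <= B) ->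
  (forall t i, 0 <= t <= T -> mu.-integrable `[0, t] (EFin \o F i) /\
    y t i = y0 i + Rintegral mu `[0, t] (F i)) ->
  (forall x i, 0 <= x <= T -> `|F i x - tridiag (y x) i| <= eta) ->
  forall P t i, 0 <= t <= T ->
    `|y t i - (taylor y0 P i).[t]| <= (remainder L B eta P).[t].
Proof.
move=> alL yB yF Feta; elim=> [|P IH] t i tT.
  rewrite /taylor /remainder !big_ord0 horner0 subr0 scaler0 addr0 expr0 mulr1.
  by rewrite hornerZ horner_exp_monom expr0 fact0 divr1 mulr1 yB.
have /andP[t0 tT'] := tT.
have [intF ->] := yF t i tT.
have := @Rintegral_poly_approx (F i) (taylor y0 P.+1 i) (remainder L B eta P.+1)
  t t0 intF.
rewrite remainderS0 subr0 taylor0 opprB addrA [y0 i + _]addrC; apply => x xt.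
have xT : 0 <= x <= T by case/andP: xt => -> /= /le_trans; apply.
rewrite deriv_taylorS deriv_remainderS.
(* The error splits into the defect of F, at most eta, and the operator applied to the previous
   error, whose norm is controlled by the row sums L. *)
rewrite -(subrKA (tridiag (y x) i)) (le_trans (ler_normD _ _))//.
rewrite addrC lerD ?Feta// /tridiag opprD addrACA -!mulrBr.
rewrite (le_trans (ler_normD _ _))// !normrM.
rewrite (@le_trans _ _ ((`|al i| + `|be i|) * (remainder L B eta P).[x]))//.
  by rewrite mulrDl; apply: lerD; rewrite ler_wpM2l ?normr_ge0 ?IH.
by rewrite ler_wpM2r// (le_trans (normr_ge0 _) (IH x i xT)).
Qed.

Lemma horner_taylor y0 P i t :
  (taylor y0 P i).[t] = \sum_(p < P) iter p tridiag y0 i * (t ^+ p / p`!%:R).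
Proof.
rewrite /taylor horner_sum; apply: eq_bigr => p _.
by rewrite hornerZ horner_exp_monom.
Qed.

Lemma taylor2 y0 i t : (taylor y0 2 i).[t] = y0 i + tridiag y0 i * t.
Proof.
rewrite horner_taylor !big_ord_recl big_ord0 /= /bump /= expr0 expr1.
by rewrite fact0 divr1 mulr1 addr0 (_ : 1`! = 1%N)// divr1.
Qed.

(** A truncation of (e^(L t) - 1) / L, the factor by which the forcing eta is amplified. *)
Definition remainder_tail (L : R) (P : nat) (t : R) : R :=
  \sum_(p < P) L ^+ p * (t ^+ p.+1 / p.+1`!%:R).

Lemma horner_remainder L B eta P t : (remainder L B eta P).[t] =
  B * L ^+ P * (t ^+ P / P`!%:R) + eta * remainder_tail L P t.
Proof.
rewrite /remainder hornerD hornerZ horner_exp_monom hornerZ horner_sum.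
congr (_ + _ * _); apply: eq_bigr => p _.
by rewrite hornerZ horner_exp_monom.
Qed.

Lemma remainder_tail_ge0 L P t : 0 <= L -> 0 <= t -> 0 <= remainder_tail L P t.
Proof.
move=> L0 t0; apply: sumr_ge0 => p _.
by rewrite mulr_ge0 ?exprn_ge0// divr_ge0 ?exprn_ge0.
Qed.

Lemma remainder_tail2 L t : remainder_tail L 2 t = t + L * t ^+ 2 / 2.
Proof.
rewrite /remainder_tail !big_ord_recl big_ord0 /= /bump /= !expr0 !expr1.
by rewrite (_ : 1`! = 1%N)// (_ : (1 + 0).+1`! = 2%N)// mul1r divr1 addr0 mulrA.
Qed.

Section NonnegativeCoefficients.
Hypotheses (al_ge0 : forall i, 0 <= al i) (be_ge0 : forall i, 0 <= be i).
Variable y0 : int -> R.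
Hypothesis y0_ge0 : forall i, 0 <= y0 i.

Lemma iter_tridiag_ge0 p i : 0 <= iter p tridiag y0 i.
Proof.
by elim: p i => // p IH i; rewrite iterS /tridiag addr_ge0// mulr_ge0.
Qed.

(* Walks that oscillate between the sites 1 and 2. *)
Lemma iter_tridiag_double q :
  (be 1 * al 2) ^+ q * y0 1 <= iter q.*2 tridiag y0 1.
Proof.
elim: q => [|q IH]; first by rewrite expr0 mul1r.
rewrite doubleS !iterS.
have step1 : be 1 * tridiag (iter q.*2 tridiag y0) 2
    <= tridiag (tridiag (iter q.*2 tridiag y0)) 1.
  rewrite [leRHS]/tridiag (_ : 1 + 1 = 2 :> int)// lerDr mulr_ge0//.
  by rewrite -iterS iter_tridiag_ge0.
apply: le_trans step1; rewrite exprS -!mulrA ler_wpM2l//.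
apply: (@le_trans _ _ (al 2 * iter q.*2 tridiag y0 1)).
  by rewrite ler_wpM2l.
rewrite [leRHS]/tridiag (_ : 2 - 1 = 1 :> int)// lerDl mulr_ge0//.
exact: iter_tridiag_ge0.
Qed.

(** All Taylor terms are nonnegative, so the term of order 2q alone is a lower bound. *)
Lemma taylor_lower_bound q P t : 0 <= t -> (q.*2 < P)%N ->
  (be 1 * al 2) ^+ q * y0 1 * (t ^+ q.*2 / q.*2`!%:R) <= (taylor y0 P 1).[t].
Proof.
move=> t0 qP; have ge0 p : 0 <= t ^+ p / p`!%:R by rewrite divr_ge0 ?exprn_ge0.
rewrite horner_taylor (bigD1 (Ordinal qP))//= ler_wpDr//.
  by apply: sumr_ge0 => p _; rewrite mulr_ge0// iter_tridiag_ge0.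
by rewrite ler_wpM2r// iter_tridiag_double.
Qed.

End NonnegativeCoefficients.

End Picard.

(** * Choice of small times and amplitudes and of the truncation order *)

Section SmallParameters.
Context {R : realType}.

Lemma small_factor (X c T : R) : 0 <= X -> 0 < c -> 0 < T ->
  exists2 t, 0 < t <= T & X * t <= c.
Proof.
move=> X0 c0 T0; have X1 : 0 < X + 1 by rewrite ltr_wpDl.
(* Dividing by X + 1 also covers X = 0. *)
exists (Num.min T (c / (X + 1))).
  by rewrite lt_min T0 divr_gt0//= ge_min lexx.
apply: (@le_trans _ _ ((X + 1) * (c / (X + 1)))).
  apply: ler_pM => //; first by rewrite le_min (ltW T0) ltW// divr_gt0.
    by rewrite lerDl.
  by rewrite ge_min lexx orbT.
by rewrite mulrCA divff ?mulr1// gt_eqF.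
Qed.

(** The terms of the exponential series tend to 0. This fixes a truncation order at which the Picard
    remainder does not exceed the a priori bound, up to the forcing. *)
Lemma exp_term_le1 (x : R) q : exists2 P, (q < P)%N & x ^+ P / P`!%:R <= 1.
Proof.
have /cvgrPdist_le /(_ 1 ltr01) [N _ NP] := cvg_exp_coeff x.
exists (N + q).+1; first by rewrite ltnS leq_addl.
have := NP (N + q).+1 (leqW (leq_addr _ _)).
rewrite sub0r normrN => /(le_trans (ler_norm _)).
by rewrite exp_coeffE mulrC.
Qed.

End SmallParameters.

(** * Linear growth of unbounded rational functions of one variable *)

Section RationalGrowth.
Context {R : realType}.
Implicit Types p q : {poly R}.

Lemma horner_upper_bound p :
  exists2 C, 0 < C & forall x, 1 <= x -> `|p.[x]| <= C * x ^+ (size p).-1.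
Proof.
exists (1 + \sum_(i < size p) `|p`_i|) => [|x x1].
  by rewrite ltr_pwDl// sumr_ge0.
rewrite horner_coef (le_trans (ler_norm_sum _ _ _))//.
rewrite mulrDl mulr_suml ler_wpDl ?mul1r ?exprn_ge0 ?(le_trans ler01)//.
apply: ler_sum => i _; rewrite normrM ler_wpM2l// ger0_norm; last first.
  by rewrite exprn_ge0// (le_trans ler01).
by rewrite ler_weXn2l// -ltnS (ltn_predK (ltn_ord i)).
Qed.

Lemma horner_lower_bound p : p != 0 ->
  exists2 c, 0 < c & exists X, forall x, X <= x -> c * x ^+ (size p).-1 <= `|p.[x]|.
Proof.
move=> p0; set s := (size p).-1; have sp : size p = s.+1.
  by rewrite prednK// size_poly_gt0.
have l0 : 0 < `|lead_coef p| by rewrite normr_gt0 lead_coef_eq0.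
pose D := \sum_(i < s) `|p`_i|.
exists (`|lead_coef p| / 2); first by rewrite divr_gt0.
(* Beyond this threshold x >= 1 and 2 D <= |lead| x, so the lower-order terms take at most half of
   the leading one. *)
exists (1 + 2 * D / `|lead_coef p|) => x Xx.
have D0 : 0 <= D by rewrite sumr_ge0.
have x1 : 1 <= x.
  by apply: le_trans Xx; rewrite lerDl divr_ge0// mulr_ge0.
have x0 : 0 < x by exact: lt_le_trans x1.
have Dx : 2 * D <= `|lead_coef p| * x.
  by rewrite [leRHS]mulrC -ler_pdivrMr// (le_trans _ Xx)// lerDr.
have lowD : x * `|\sum_(i < s) p`_i * x ^+ i| <= D * x ^+ s.
  rewrite -[x in x * _]gtr0_norm// -normrM mulr_sumr.
  rewrite (le_trans (ler_norm_sum _ _ _))// mulr_suml; apply: ler_sum => i _.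
  rewrite mulrCA normrM ler_wpM2l//. rewrite -exprS ger0_norm ?exprn_ge0 ?(ltW x0)//.
  by rewrite ler_weXn2l.
rewrite -(ler_pM2l x0) horner_coef sp big_ord_recr /=.
have -> : p`_s = lead_coef p by rewrite lead_coefE.
set S := \sum_(i < s) _ in lowD *.
have : x * `|lead_coef p * x ^+ s| <= x * `|S + lead_coef p * x ^+ s| + x * `|S|.
  rewrite -mulrDr ler_wpM2l ?(ltW x0)//.
  rewrite -{1}[lead_coef p * _](addKr S) addrC.
  by rewrite (le_trans (ler_normB _ _))// addrC lerD2r addrC.
rewrite normrM (ger0_norm (exprn_ge0 _ (ltW x0))).
have : 2 * D * x ^+ s <= `|lead_coef p| * x * x ^+ s.
  by rewrite ler_wpM2r ?exprn_ge0 ?(ltW x0).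
by move: lowD; nra.
Qed.

(** If deg p <= deg q, the quotient would stay below Cp / cq at large integers. Hence deg p >= deg q
    + 1, and the bounds by leading powers leave at least one factor j. *)
Lemma rational_linear_growth p q (f : nat -> R) :
  (forall j, (0 < j)%N -> q.[j%:R] != 0 /\ f j = p.[j%:R] / q.[j%:R]) ->
  (forall M, exists J, forall j, (J <= j)%N -> M <= f j) ->
  exists2 c, 0 < c & exists J, forall j, (J <= j)%N -> c * j%:R <= f j.
Proof.
move=> fpq finf.
have q0 : q != 0.
  by apply: contraTneq isT => q0; have [] := fpq 1%N isT; rewrite q0 horner0 eqxx.
have p0 : p != 0.
  apply/eqP => p0; have [J /(_ J.+1 (leqnSn _))] := finf 1.
  by have [_ ->] := fpq J.+1 isT; rewrite p0 horner0 mul0r ler10.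
have [Cp Cp0 upp] := horner_upper_bound p.
have [Cq Cq0 upq] := horner_upper_bound q.
have [cp cp0 [Xp lowp]] := horner_lower_bound p0.
have [cq cq0 [Xq lowq]] := horner_lower_bound q0.
have [Jp Jpp] : exists J : nat, Xp <= J%:R.
  by exists (Num.truncn Xp).+1; exact/ltW/truncnS_gt.
have [Jq Jqq] : exists J : nat, Xq <= J%:R.
  by exists (Num.truncn Xq).+1; exact/ltW/truncnS_gt.
have [spq|sqp] := leqP (size p) (size q).
  have [J Jf] := finf (Cp / cq + 1).
  pose j := (J + Jq).+1.
  have j1 : 1 <= j%:R :> R by rewrite ler1n.
  have := Jf j (leqW (leq_addr _ _)); have [qj ->] := fpq j isT.
  rewrite real_leNgt ?num_real// => /negP[].
  rewrite (le_lt_trans (ler_norm _))// ltr_pwDr// normrM normfV.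
  rewrite ler_pdivrMr ?normr_gt0// (le_trans (upp _ j1))//.
  rewrite mulrAC -mulrA ler_wpM2l ?(ltW Cp0)// ler_pdivlMr// mulrC.
  apply: le_trans (lowq _ _); last first.
    by rewrite (le_trans Jqq)// ler_nat (leq_trans (leq_addl J _)).
  rewrite ler_wpM2l ?(ltW cq0)// ler_weXn2l//.
  by rewrite -!subn1 leq_sub2r.
exists (cp / Cq); first by rewrite divr_gt0.
(* Eventual nonnegativity allows f to be replaced by its absolute value, which the polynomial bounds
   control. *)
have [J Jf] := finf 0.
exists (J + Jp).+1 => j Jj.
have j0 : (0 < j)%N by case: j Jj.
have j1 : 1 <= j%:R :> R by rewrite ler1n.
have jpos : 0 < j%:R :> R by rewrite ltr0n.
have fj0 : 0 <= f j by rewrite Jf// (leq_trans _ Jj)// leqW ?leq_addr.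
rewrite -[f j]ger0_norm//; have [qj ->] := fpq j j0.
rewrite normrM normfV ler_pdivlMr ?normr_gt0//.
have /(ler_wpM2l (x := cp / Cq * j%:R)) := upq _ j1.
move=> /(_ (mulr_ge0 (divr_ge0 (ltW cp0) (ltW Cq0)) (ltW jpos))) /le_trans; apply.
rewrite mulrACA -exprS divfK ?gt_eqF//.
apply: le_trans (lowp _ _); last first.
  by rewrite (le_trans Jpp)// ler_nat (leq_trans _ Jj)// leqW ?leq_addl.
rewrite ler_wpM2l ?(ltW cp0)// ler_weXn2l// prednK ?size_poly_gt0//.
by rewrite -ltnS prednK// size_poly_gt0.
Qed.

(** Serves to restrict a rational symbol to a line parallel to a coordinate axis. *)
Lemma horner_polyZ_line n (i0 : 'I_n.+1) (w : Zd n) N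
    (c : {ffun 'I_n.+1 -> 'I_N} -> R) :
  exists p : {poly R}, forall k : Zd n, (forall i, i != i0 -> k 0 i = w 0 i) ->
    polyZ c k = p.[(k 0 i0)%:~R].
Proof.
exists (\sum_e (c e)%:P *
  \prod_i (if i == i0 then 'X else ((w 0 i)%:~R)%:P) ^+ e i) => k kw.
rewrite /polyZ horner_sum; apply: eq_bigr => e _.
rewrite hornerM hornerC horner_prod; congr (_ * _); apply: eq_bigr => i _.
rewrite horner_exp; congr (_ ^+ _); case: eqVneq => [->|/kw ->].
  by rewrite hornerX.
by rewrite hornerC.
Qed.

End RationalGrowth.

(** * Sobolev norms of Fourier coefficients and real waves *)

Section SobolevCoefficients.
Context {R : realType} {n : nat}.
Implicit Types (k p : Zd n) (f g : coef R n).

Lemma esumZ_le (T : choiceType) (c : R) (a : T -> R) : 0 <= c ->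
  (forall x, 0 <= a x) ->
  (\esum_(x in [set: T]) (c * a x)%:E <= c%:E * \esum_(x in [set: T]) (a x)%:E)%E.
Proof.
move=> c0 a0; apply: ge_ereal_sup => _ [X [finX _] <-].
under eq_fsbigr do rewrite EFinM.
rewrite -ge0_mule_fsumr; last by move=> x; rewrite lee_fin.
by rewrite lee_wpmul2l ?lee_fin//; apply: esum_ge; exists X.
Qed.

Lemma normZN k : normZ R (- k) = normZ R k.
Proof.
rewrite /normZ; congr Num.sqrt; apply: eq_bigr => i _.
by rewrite mxE rmorphN sqrrN.
Qed.

Lemma normZ_ge0 (d : nat) (k : 'rV[int]_d) : 0 <= normZ R k.
Proof. exact: sqrtr_ge0. Qed.

Lemma normZ_sqr (d : nat) (k : 'rV[int]_d) :
  normZ R k ^+ 2 = \sum_i ((k 0 i)%:~R) ^+ 2.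
Proof. by rewrite sqr_sqrtr// sumr_ge0// => i _; rewrite sqr_ge0. Qed.

Lemma sqmodC_ge0 (z : R[i]) : 0 <= sqmodC z.
Proof. by rewrite addr_ge0 ?sqr_ge0. Qed.

Lemma sqmodC0 : sqmodC (0 : R[i]) = 0.
Proof. by rewrite /sqmodC /= expr0n/= addr0. Qed.

Lemma sqmodCJ (z : R[i]) : sqmodC (conjc z) = sqmodC z.
Proof. by case: z => x y; rewrite /sqmodC /= sqrrN. Qed.

Lemma sqmodCN (z : R[i]) : sqmodC (- z) = sqmodC z.
Proof. by case: z => x y; rewrite /sqmodC /= !sqrrN. Qed.

(** The doubling is written as a sum so that it passes to extended sums through [esumD]. *)
Lemma sqmodCD_le (z w : R[i]) :
  sqmodC (z + w) <= (sqmodC z + sqmodC z) + (sqmodC w + sqmodC w).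
Proof.
case: z w => x y [u v]; rewrite /sqmodC /=.
have := sqr_ge0 (x - u); have := sqr_ge0 (y - v); nra.
Qed.

Definition weight (s : R) k : R := powR (1 + normZ R k ^+ 2) s.

Lemma weight_ge0 s k : 0 <= weight s k.
Proof. exact: powR_ge0. Qed.

Lemma weight_ge1 s k : 0 <= s -> 1 <= weight s k.
Proof.
by move=> s0; rewrite -(powRr0 (1 + normZ R k ^+ 2)) ler_powR// lerDl sqr_ge0.
Qed.

Lemma Hs_term_ge0 s f k : 0 <= weight s k * sqmodC (f k).
Proof. by rewrite mulr_ge0 ?weight_ge0 ?sqmodC_ge0. Qed.

Lemma Hs_sq_ge0 s f : (0 <= Hs_sq s f)%E.
Proof. by apply: esum_ge0 => k _; rewrite lee_fin Hs_term_ge0. Qed.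

Lemma Hs_sqE s f : (Hs_sq s f < +oo)%E -> Hs_sq s f = (Hs_norm s f ^+ 2)%:E.
Proof.
move=> fin; rewrite /Hs_norm sqr_sqrtr ?fine_ge0 ?Hs_sq_ge0// fineK//.
by rewrite ge0_fin_numE ?Hs_sq_ge0.
Qed.

Lemma Hs_norm_ge0 s f : 0 <= Hs_norm s f.
Proof. exact: sqrtr_ge0. Qed.

Lemma Hs_sqD_le s f g : (Hs_sq s (fun k => (f k + g k)%R) <=
  (Hs_sq s f + Hs_sq s f) + (Hs_sq s g + Hs_sq s g))%E.
Proof.
rewrite /Hs_sq -!esumD; try by move=> k _; rewrite ?adde_ge0// lee_fin Hs_term_ge0.
apply: le_esum => k _; rewrite -!EFinD lee_fin -!mulrDr ler_wpM2l ?weight_ge0//.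
exact: sqmodCD_le.
Qed.

Lemma Hs_sqN s f : Hs_sq s (fun k => - f k) = Hs_sq s f.
Proof. by apply: eq_esum => k _; rewrite sqmodCN. Qed.

Lemma in_HsB s f g : in_Hs s f -> in_Hs s g -> in_Hs s (fun k => f k - g k).
Proof.
move=> [hf sf] [hg sg]; split.
  by move=> k; rewrite hf hg rmorphB.
apply: le_lt_trans (Hs_sqD_le s f (fun k => - g k)) _.
by rewrite Hs_sqN !lte_add_pinfty.
Qed.

Lemma in_HsD s f g : in_Hs s f -> in_Hs s g -> in_Hs s (fun k => f k + g k).
Proof.
move=> [hf sf] [hg sg]; split.
  by move=> k; rewrite hf hg rmorphD.
by apply: le_lt_trans (Hs_sqD_le s f g) _; rewrite !lte_add_pinfty.
Qed.

Lemma Hs_norm_sqrD_le s f g : in_Hs s f -> in_Hs s g ->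
  Hs_norm s (fun k => f k + g k) ^+ 2 <=
    2 * Hs_norm s f ^+ 2 + 2 * Hs_norm s g ^+ 2.
Proof.
move=> Hf Hg; have [_ sfg] := in_HsD Hf Hg; case: Hf Hg => _ sf [_ sg].
have := Hs_sqD_le s f g.
rewrite (Hs_sqE sfg) (Hs_sqE sf) (Hs_sqE sg) -!EFinD lee_fin; lra.
Qed.

(** For s >= 0 every weight is at least 1, so one term of the sum dominates the coefficient. *)
Lemma sqmodC_le_Hs s f k : 0 <= s -> (Hs_sq s f < +oo)%E ->
  sqmodC (f k) <= Hs_norm s f ^+ 2.
Proof.
move=> s0 sf; rewrite -lee_fin -Hs_sqE//.
rewrite -(@esum_single _ _ k (sqmodC (f k))%:E) ?lee_fin ?sqmodC_ge0//.
apply: le_esum => j _; case: eqVneq => [->|_]; rewrite lee_fin ?Hs_term_ge0//.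
by rewrite ler_peMl ?sqmodC_ge0 ?weight_ge1.
Qed.

Lemma Re_le_Hs s f k : 0 <= s -> (Hs_sq s f < +oo)%E ->
  `|complex.Re (f k)| <= Hs_norm s f.
Proof.
move=> s0 sf; rewrite -ler_sqr ?nnegrE ?Hs_norm_ge0//.
apply: le_trans (sqmodC_le_Hs k s0 sf).
by rewrite real_normK ?num_real// lerDl sqr_ge0.
Qed.

(* Coefficients of z e^{ip.x} + conj(z) e^{-ip.x}, for p != 0. *)
Definition wave p (z : R[i]) : coef R n :=
  fun k => if k == p then z else if k == - p then conjc z else 0.

Lemma eqN_rV (d : nat) (k : 'rV[int]_d) : k != 0 -> (- k == k) = false.
Proof.
apply: contraNF => /eqP /matrixP e; apply/eqP/matrixP => i j.
by apply/eqP; rewrite mxE -eqNr; have := e i j; rewrite mxE => ->.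
Qed.

Lemma hermitian_wave p z : p != 0 -> Defs.hermitian (wave p z).
Proof.
move=> p0 k; rewrite /wave eqr_oppLR eqr_opp.
case: (eqVneq k (- p)) => [->|_]; first by rewrite eqN_rV// conjcK.
by case: ifP => // _; rewrite rmorph0.
Qed.

Lemma Hs_sq_wave s p z : p != 0 ->
  Hs_sq s (wave p z) = (2 * (weight s p * sqmodC z))%:E.
Proof.
move=> p0; set A := weight s p * sqmodC z.
have A0 : (0 <= A%:E :> \bar R)%E.
  by rewrite lee_fin mulr_ge0 ?weight_ge0 ?sqmodC_ge0.
transitivity (\esum_(k in [set: Zd n])
   ((if k == p then A%:E else 0) + (if k == (- p)%R then A%:E else 0)))%E.
  apply: eq_esum => k _; rewrite /wave -/(weight s k).
  case: (eqVneq k p) => [->|kp].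
    by rewrite eq_sym eqN_rV// adde0.
  case: (eqVneq k (- p)) => [->|_]; last by rewrite sqmodC0 mulr0 adde0.
  by rewrite add0e /A sqmodCJ /weight normZN.
rewrite esumD; try by move=> k _; case: ifP.
by rewrite !esum_single// -EFinD; congr EFin; ring.
Qed.

Lemma in_Hs_wave s p z : p != 0 -> in_Hs s (wave p z).
Proof. by move=> p0; split; [exact: hermitian_wave|rewrite Hs_sq_wave// ltry]. Qed.

Lemma Hs_norm_wave s p z : p != 0 ->
  Hs_norm s (wave p z) ^+ 2 = 2 * (weight s p * sqmodC z).
Proof.
move=> p0; have [_ fin] := in_Hs_wave s z p0.
by have := Hs_sqE fin; rewrite Hs_sq_wave// => -[].
Qed.

End SobolevCoefficients.

(** * Arithmetic of the lattice points (k', c) *)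

Section LatticePoints.
Context {n : nat}.
Implicit Types (k l : 'rV[int]_n) (c d : int).

Lemma ptZ_last k c : ptZ k c 0 ord_max = c.
Proof. by rewrite mxE unlift_none. Qed.

Lemma ptZ_lift k c i : ptZ k c 0 (lift ord_max i) = k 0 i.
Proof. by rewrite mxE liftK. Qed.

Lemma ptZD k l c d : ptZ k c + ptZ l d = ptZ (k + l) (c + d).
Proof.
by apply/rowP => i; rewrite !mxE; case: (unlift _ _) => [j|]; rewrite ?mxE.
Qed.

Lemma ptZN k c : - ptZ k c = ptZ (- k) (- c).
Proof.
by apply/rowP => i; rewrite !mxE; case: (unlift _ _) => [j|]; rewrite ?mxE.
Qed.

Lemma eq_ptZ k l c d : (ptZ k c == ptZ l d) = (k == l) && (c == d).
Proof.
apply/eqP/andP => [e|[/eqP -> /eqP ->]//]; split; last first.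
  by rewrite -(ptZ_last k c) e ptZ_last.
by apply/eqP/rowP => i; rewrite -(ptZ_lift k c) e ptZ_lift.
Qed.

Lemma ptZ_eq0 k c : (ptZ k c == 0) = (k == 0) && (c == 0).
Proof.
by rewrite -eq_ptZ; congr (_ == _); apply/rowP => i; rewrite !mxE; case: unlift => *;
  rewrite ?mxE.
Qed.

End LatticePoints.

(** * Expansion of the nonlinearity around the steady state *)

Section LinearizedNonlinearity.
Context {R : realType} {n : nat}.
Implicit Types (k j : Zd n) (f g d : coef R n).

Lemma dotRZD (v : 'rV[R]_n.+1) k j : dotRZ v (k + j) = dotRZ v k + dotRZ v j.
Proof.
rewrite /dotRZ -big_split /=; apply: eq_bigr => i _.
by rewrite mxE rmorphD mulrDr.
Qed.

Lemma dotRZN (v : 'rV[R]_n.+1) k : dotRZ v (- k) = - dotRZ v k.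
Proof.
rewrite /dotRZ -sumrN; apply: eq_bigr => i _.
by rewrite mxE rmorphN mulrN.
Qed.

Lemma dot0RZ k : dotRZ (0 : 'rV[R]_n.+1) k = 0.
Proof. by rewrite /dotRZ big1 // => i _; rewrite mxE mul0r. Qed.

Lemma dotRZ_ptZ (v : 'rV[R]_n.+1) (k' : 'rV[int]_n) c :
  dotRZ v (ptZ k' c) =
    \sum_(i < n) v 0 (lift ord_max i) * (k' 0 i)%:~R + v 0 ord_max * c%:~R.
Proof.
rewrite /dotRZ (bigD1_ord ord_max)//= ptZ_last addrC; congr (_ + _).
by apply: eq_bigr => i _; rewrite ptZ_lift.
Qed.

Lemma normZ_sqr_ptZ (k' : 'rV[int]_n) c :
  normZ R (ptZ k' c) ^+ 2 = normZ R k' ^+ 2 + c%:~R ^+ 2.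
Proof.
rewrite !normZ_sqr (bigD1_ord ord_max)//= ptZ_last addrC; congr (_ + _).
by apply: eq_bigr => i _; rewrite ptZ_lift.
Qed.

Variables (m : Zd n -> 'rV[R]_n.+1).

(** Real part of the j-th term of the k-th coefficient of (M f) . grad g. Real parts suffice: the
    steady state has imaginary coefficients, so its product with the factor i is real and the
    linearization acts on real parts alone. *)
Definition bil f g k j : R :=
  - dotRZ (m j) (k - j) * (complex.Re (f j) * complex.Im (g (k - j))
                         + complex.Im (f j) * complex.Re (g (k - j))).

Lemma Re_nl f k : complex.Re (nl m f k) = rsum (bil f f k).
Proof.
rewrite /nl /csum /=; congr rsum; apply/funext => j.
rewrite /nl_term /bil; case: (f j) => x y; case: (f (k - j)) => u v /=.
ring.
Qed.

Lemma normr_le_addP (p u v : R) : 0 <= u -> 0 <= v -> p ^+ 2 <= u * v ->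
  `|p| <= u + v.
Proof.
move=> u0 v0 puv; rewrite -ler_sqr ?nnegrE ?addr_ge0// real_normK ?num_real//.
nra.
Qed.

(** Coordinate by coordinate, |x y Im(z w)| <= |x z| |y w|, which is at most the sum of the two
    squares. Each square can then be summed over j separately. *)
Lemma bil_le d k j : `|bil d d k j| <=
  normRv (m j) ^+ 2 * sqmodC (d j) + normZ R (k - j) ^+ 2 * sqmodC (d (k - j)).
Proof.
rewrite /bil mulNr normrN normZ_sqr /normRv sqr_sqrtr ?sumr_ge0//; last first.
  by move=> i _; rewrite sqr_ge0.
rewrite /dotRZ !mulr_suml -big_split (le_trans (ler_norm_sum _ _ _))//.
apply: ler_sum => i _.
set x : R := m j 0 i; set y : R := _%:~R; case: (d j) (d (k - j)) => p q [u v] /=.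
apply: normr_le_addP; [exact: mulr_ge0 (sqr_ge0 _) (sqmodC_ge0 _)..|].
rewrite /sqmodC /= !exprMn.
(* Lagrange's identity: |z|^2 |w|^2 = Im(z w)^2 + Re(z w)^2. *)
have -> : x ^+ 2 * (p ^+ 2 + q ^+ 2) * (y ^+ 2 * (u ^+ 2 + v ^+ 2)) =
  x ^+ 2 * y ^+ 2 * ((p * v + q * u) ^+ 2 + (p * u - q * v) ^+ 2) by ring.
by rewrite ler_wpM2l ?(mulr_ge0 (sqr_ge0 _) (sqr_ge0 _))// lerDl sqr_ge0.
Qed.

Variables (r0 C r : R).
Hypotheses (r0r : r0 <= r) (r1 : 1 <= r).
Hypothesis m_growth : forall k, normRv (m k) <= C * powR (1 + normZ R k) r0.

(** Combines r0 <= r with (1 + |k|)^2 <= 2 (1 + |k|^2), raised to the power r. *)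
Lemma symbol_sqr_le k : normRv (m k) ^+ 2 <= C ^+ 2 * powR 2 r * weight r k.
Proof.
have w1 : 1 <= 1 + normZ R k by rewrite lerDl normZ_ge0.
have w0 : 0 <= 1 + normZ R k by exact: le_trans w1.
have m0 : 0 <= normRv (m k) by exact: sqrtr_ge0.
apply: (@le_trans _ _ ((C * powR (1 + normZ R k) r0) ^+ 2)).
  by rewrite ler_sqr ?nnegrE// (le_trans m0).
rewrite exprMn -mulrA ler_wpM2l ?sqr_ge0// /weight -powRM//; last first.
  by rewrite addr_ge0 ?sqr_ge0.
apply: (@le_trans _ _ (powR (1 + normZ R k) r ^+ 2)).
  by rewrite ler_sqr ?nnegrE ?powR_ge0// ler_powR.
rewrite -powR_mulrn ?powR_ge0// -powRrM mulrC powRrM powR_mulrn//.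
rewrite ge0_ler_powR ?nnegrE ?sqr_ge0 ?(le_trans _ r1)//.
  by rewrite mulr_ge0// addr_ge0 ?sqr_ge0.
have := sqr_ge0 (1 - normZ R k); nra.
Qed.

Lemma frequency_sqr_le k : normZ R k ^+ 2 <= weight r k.
Proof.
apply: (@le_trans _ _ (weight 1 k)).
  by rewrite /weight powRr1 ?lerDr// addr_ge0 ?sqr_ge0.
by rewrite /weight ler_powR// lerDl sqr_ge0.
Qed.

Definition quad_const : R := C ^+ 2 * powR 2 r + 1.

Lemma quad_const_ge0 : 0 <= quad_const.
Proof. by rewrite addr_ge0// mulr_ge0 ?sqr_ge0 ?powR_ge0. Qed.

Lemma bil_sum_le d k : (Hs_sq r d < +oo)%E ->
  (\esum_(j in [set: Zd n]) (normRv (m j) ^+ 2 * sqmodC (d j)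
     + normZ R (k - j) ^+ 2 * sqmodC (d (k - j)))%:E
   <= (quad_const * Hs_norm r d ^+ 2)%:E)%E.
Proof.
move=> fin.
under eq_esum do rewrite EFinD.
rewrite esumD; try by move=> j _; rewrite lee_fin mulr_ge0 ?sqr_ge0 ?sqmodC_ge0.
rewrite /quad_const mulrDl mul1r EFinD EFinM -Hs_sqE//; apply: leeD.
  apply: le_trans (esumZ_le _ (Hs_term_ge0 r d)); last first.
    by rewrite mulr_ge0 ?sqr_ge0 ?powR_ge0.
  apply: le_esum => j _; rewrite lee_fin mulrA ler_wpM2r ?sqmodC_ge0//.
  exact: symbol_sqr_le.
(* The substitution l = k - j makes the bound independent of k. *)
rewrite -(@reindex_esum _ _ _ setT setT (fun j => k - j)
  (fun l => (normZ R l ^+ 2 * sqmodC (d l))%:E)); last first.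
  split=> // [j1 j2 _ _ /addrI /oppr_inj //|l _].
  by exists (k - l) => //=; rewrite subKr.
apply: le_esum => j _; rewrite lee_fin ler_wpM2r ?sqmodC_ge0//.
exact: frequency_sqr_le.
Qed.

Lemma rsummable_bil d k : (Hs_sq r d < +oo)%E -> rsummable (bil d d k).
Proof. by move=> fin; apply: rsummableP (bil_le d k) (bil_sum_le k fin). Qed.

Lemma rsum_bil_le d k : (Hs_sq r d < +oo)%E ->
  `|rsum (bil d d k)| <= quad_const * Hs_norm r d ^+ 2.
Proof. by move=> fin; apply: rsum_le (bil_le d k) (bil_sum_le k fin). Qed.

Variable a : nat.
Hypothesis a_gt0 : (0 < a)%N.
Local Notation ae := (ptZ (0 : 'rV[int]_n) a%:Z).
Hypothesis m_ae : m ae = 0.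
Hypothesis m_Nae : m (- ae) 0 ord_max = 0.

(** Coefficients of -sin(a x_d): i/2 at a e_d and -i/2 at -a e_d. *)
Definition base : coef R n := wave ae (Complex 0 (2^-1)).

Lemma ae_neq0 : ae != 0.
Proof. by rewrite ptZ_eq0 eqxx /=; case: (a) a_gt0. Qed.

Lemma Re_base k : complex.Re (base k) = 0.
Proof. by rewrite /base /wave; case: ifP => // _; case: ifP. Qed.

Lemma Im_base k : complex.Im (base k) =
  (if k == ae then 2^-1 else 0) + (if k == - ae then - 2^-1 else 0).
Proof.
rewrite /base /wave; case: eqVneq => [->|_].
  by rewrite eq_sym eqN_rV ?ae_neq0// addr0.
by case: ifP; rewrite add0r.
Qed.

Lemma dotRZ_ae (v : 'rV[R]_n.+1) : dotRZ v ae = v 0 ord_max * a%:R.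
Proof.
by rewrite dotRZ_ptZ big1 ?add0r// => i _; rewrite mxE mulr0.
Qed.

(** At j = a e_d the symbol vanishes. At j = -a e_d the other factor lives at frequencies parallel
    to e_d, so only the last component of the symbol enters, and it is 0. *)
Lemma nl_term_base k j : nl_term m base k j = 0.
Proof.
rewrite /nl_term.
have [->|jae] := eqVneq j ae; first by rewrite m_ae dot0RZ !mul0r.
have [->|jNae] := eqVneq j (- ae); last first.
  by rewrite /base /wave (negPf jae) (negPf jNae) mulr0 mul0r.
have [e|e] := eqVneq (k - (- ae)) ae.
  by rewrite e dotRZ_ae m_Nae !mul0r.
have [{}e|e'] := eqVneq (k - (- ae)) (- ae).
  by rewrite e dotRZN dotRZ_ae m_Nae mul0r oppr0 !mul0r.
by rewrite /base /wave (negPf e) (negPf e') mulr0.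
Qed.

Lemma nl_base k : nl m base k = 0.
Proof.
rewrite /nl (funext (nl_term_base k)) /csum /rsum /=.
by rewrite !esum1 ?subrr// => j _; rewrite ?oppr0 maxxx.
Qed.

(** At j = -a e_d the steady state supplies the velocity; at j = k - a e_d and j = k + a e_d it is
    the transported quantity. The index j = a e_d drops out by m(a e_d) = 0, and products of two
    base coefficients have no effect on real parts. Indicators are added because the three indices
    may coincide. *)
Lemma bil_base_add d k j : bil (fun l => base l + d l) (fun l => base l + d l) k j =
  (if j == - ae then 2^-1 * dotRZ (m (- ae)) k * complex.Re (d (k + ae)) else 0)
  + ((if j == k - ae then
       - (a%:R / 2) * m (k - ae) 0 ord_max * complex.Re (d (k - ae)) else 0)
  + ((if j == k + ae then
       - (a%:R / 2) * m (k + ae) 0 ord_max * complex.Re (d (k + ae)) else 0)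
  + bil d d k j)).
Proof.
have ReD l : complex.Re (base l + d l) = complex.Re (d l).
  by rewrite raddfD /= Re_base add0r.
have ImD l : complex.Im (base l + d l) = complex.Im (base l) + complex.Im (d l).
  by rewrite raddfD.
have flip l : (j == k - l) = (k - j == l).
  by rewrite eq_sym !subr_eq addrC.
rewrite /bil !ReD !ImD.
have -> : (if j == - ae then
     2^-1 * dotRZ (m (- ae)) k * complex.Re (d (k + ae)) else 0) =
   - dotRZ (m j) (k - j) * (complex.Im (base j) * complex.Re (d (k - j))).
  rewrite Im_base; case: eqVneq => [->|_].
    rewrite eqN_rV ?ae_neq0// opprK dotRZD dotRZ_ae m_Nae add0r; ring.
  by case: eqVneq => [->|_]; rewrite ?m_ae ?dot0RZ addr0 ?mul0r; ring.
have -> : (if j == k - ae then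
     - (a%:R / 2) * m (k - ae) 0 ord_max * complex.Re (d (k - ae)) else 0) =
   - dotRZ (m j) (k - j) * (complex.Re (d j) * (if k - j == ae then 2^-1 else 0)).
  rewrite flip; case: eqVneq => [kj|_]; last by rewrite !mulr0.
  have -> : k - ae = j by rewrite -kj subKr.
  by rewrite kj dotRZ_ae; ring.
have -> : (if j == k + ae then
     - (a%:R / 2) * m (k + ae) 0 ord_max * complex.Re (d (k + ae)) else 0) =
   - dotRZ (m j) (k - j) * (complex.Re (d j) *
     (if k - j == - ae then - 2^-1 else 0)).
  rewrite -{1}[ae]opprK flip; case: eqVneq => [kj|_]; last by rewrite !mulr0.
  have -> : k + ae = j by rewrite -[ae]opprK -kj subKr.
  by rewrite kj dotRZN dotRZ_ae; ring.
rewrite [complex.Im (base (k - j))]Im_base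
  [(_ + _) * complex.Re _]mulrDl !mulrDr addrACA.
by rewrite addrAC [RHS]addrA [RHS]addrA addrA addrC !addrA.
Qed.

Lemma Re_nl_base_add d k : (Hs_sq r d < +oo)%E ->
  complex.Re (nl m (fun l => base l + d l) k) =
    2^-1 * dotRZ (m (- ae)) k * complex.Re (d (k + ae))
    - a%:R / 2 * (m (k - ae) 0 ord_max * complex.Re (d (k - ae))
                  + m (k + ae) 0 ord_max * complex.Re (d (k + ae)))
    + rsum (bil d d k).
Proof.
move=> fin; rewrite Re_nl (funext (bil_base_add d k)).
have [s1 e1] := rsum_single_add (k + ae) (- (a%:R / 2) *
  m (k + ae) 0 ord_max * complex.Re (d (k + ae))) (rsummable_bil k fin).
have [s2 e2] := rsum_single_add (k - ae) (- (a%:R / 2) *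
  m (k - ae) 0 ord_max * complex.Re (d (k - ae))) s1.
have [_ e3] := rsum_single_add (- ae) (2^-1 *
  dotRZ (m (- ae)) k * complex.Re (d (k + ae))) s2.
rewrite e3 e2 e1; ring.
Qed.

End LinearizedNonlinearity.

(** * Growth of one mode under the assumption of well-posedness *)

Section IllPosedness.
Context {R : realType} {n : nat}.
Variables (m : Zd n -> 'rV[R]_n.+1) (a : nat) (r0 C r s : R).
Hypotheses (a_gt0 : (0 < a)%N) (r0r : r0 <= r) (r1 : 1 <= r).
Local Notation ae := (ptZ (0 : 'rV[int]_n) a%:Z).
Local Notation mu := (@lebesgue_measure R).
Hypothesis m_ae : m ae = 0.
Hypothesis m_even : forall k, m (- k) 0 ord_max = m k 0 ord_max.
Hypothesis m_growth : forall k, normRv (m k) <= C * powR (1 + normZ R k) r0.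
Hypothesis m_pos : forall (k' : 'rV[int]_n) (c : int), k' != 0 ->
  0 < m (ptZ k' c) 0 ord_max.
Hypothesis m_decr : forall (k' : 'rV[int]_n) (N : nat), k' != 0 -> (0 < N)%N ->
  m (ptZ k' (N.+1 * a)%:Z) 0 ord_max < m (ptZ k' (N * a)%:Z) 0 ord_max.

Local Notation bs := (base a : coef R n).

Lemma m_Nae : m (- ae) 0 ord_max = 0.
Proof. by rewrite m_even m_ae mxE. Qed.

Lemma base_solution T : is_solution m r T bs (fun=> bs).
Proof.
have nl0 := nl_base m_ae m_Nae.
split=> //.
- by move=> t _; apply: in_Hs_wave; exact: ae_neq0.
- by exists (Hs_norm r bs).
- move=> t k _; rewrite /csummable /summable esum1 ?ltry// => j _.
  by rewrite (nl_term_base m_ae m_Nae) sqmodC0 sqrtr0 /= normr0.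
- move=> t k _; rewrite /= nl0; split; first by split; exact: integrable0.
  by rewrite /cintegral /Rintegral /= !integral0 /= subr0.
Qed.

Lemma is_solution_le (T T' : R) th0 th : T <= T' ->
  is_solution m r T' th0 th -> is_solution m r T th0 th.
Proof.
move=> TT' [s0 sH [B sB] ss si].
have w t : 0 <= t <= T -> 0 <= t <= T' by case/andP=> -> /= /le_trans; apply.
split=> //.
- by move=> t /w; exact: sH.
- by exists B => t /w; exact: sB.
- by move=> t k /w; exact: ss.
- by move=> t k /w; exact: si.
Qed.

Lemma Hs_norm_wave_real (p : Zd n) (e : R) : p != 0 -> 0 <= e ->
  Hs_norm s (wave p (Complex e 0)) = e * Hs_norm s (wave p (Complex 1 0)).
Proof.
move=> p0 e0; apply: (pexpIrn (n := 2)) => //.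
- by rewrite nnegrE Hs_norm_ge0.
- by rewrite nnegrE mulr_ge0 ?Hs_norm_ge0.
- by rewrite exprMn !Hs_norm_wave// /sqmodC /=; ring.
Qed.

(** What is retained of well-posedness: T and K do not depend on the frequency p; only the
    admissible amplitude e0 may. *)
Definition controlled_growth (T K : R) := forall p : Zd n, p != 0 ->
  exists2 e0, 0 < e0 & forall e, 0 < e <= e0 ->
    exists2 u, is_solution m r T (fun k => bs k + wave p (Complex e 0) k) u &
      forall t, 0 <= t <= T -> Hs_norm r (fun k => u t k - bs k) <=
        K * (e * Hs_norm s (wave p (Complex 1 0))).

Lemma perturbed_solution : lip_wellposed m r s ->
  exists T K : R, [/\ 0 < T, 0 < K & controlled_growth T K].
Proof.
move=> [Tf [Kf [_ _ TK0 TKmono WP]]].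
(* Y bounds the norm of all perturbed data once the wave has norm at most 1; monotonicity then
   allows T and K to be evaluated at (X, Y). *)
set X := Hs_norm s bs; pose Y := Num.sqrt (2 * X ^+ 2 + 2).
have X0 : 0 <= X by exact: Hs_norm_ge0.
have Y0 : 0 <= Y by exact: sqrtr_ge0.
have YE : Y ^+ 2 = 2 * X ^+ 2 + 2.
  by rewrite sqr_sqrtr// addr_ge0// mulr_ge0// sqr_ge0.
have [T0 K0] := TK0 X Y X0 Y0.
have aeN0 : ae != 0 by exact: ae_neq0.
exists (Tf X Y), (Kf X Y); split=> // p p0.
pose w := weight s p : R.
have w0 : 0 <= w by exact: weight_ge0.
(* For such amplitudes e the squared norm 2 w e^2 of the wave is at most 1. *)
exists (1 + 2 * w)^-1; first by rewrite invr_gt0 ltr_pwDl// mulr_ge0.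
move=> e /andP[e0 ele].
set ph := wave p (Complex e 0).
have Hbs : in_Hs s bs by exact: in_Hs_wave.
have Hph : in_Hs s ph by exact: in_Hs_wave.
have [u1 [u2 []]] := WP _ _ Hbs (in_HsD Hbs Hph).
set Z := Hs_norm s (fun k => bs k + ph k).
have ZY : Z <= Y.
  rewrite -ler_sqr ?nnegrE ?Hs_norm_ge0// YE.
  apply: le_trans (Hs_norm_sqrD_le Hbs Hph) _; rewrite lerD2l.
  rewrite -[leRHS]mulr1 ler_wpM2l// Hs_norm_wave// -/w /sqmodC /= expr0n addr0.
  have e1 : e * (1 + 2 * w) <= 1 by rewrite -ler_pdivlMr ?mul1r ?ltr_pwDl ?mulr_ge0.
  nra.
have [_ [TZ [_ KZ]]] := TKmono Z Y X (Hs_norm_ge0 _ _) ZY X0.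
move=> [_ uniq1] [sol2 _] lip.
exists u2; first exact: is_solution_le TZ sol2.
move=> t /andP[t0 tT]; have tZ : 0 <= t <= Tf X Z by rewrite t0 (le_trans tT).
(* By uniqueness the first solution is the steady state, so the Lipschitz bound controls the
   perturbation. *)
have := lip t tZ; rewrite -(uniq1 _ (base_solution _) t tZ) => le1.
have -> : Hs_norm r (fun k => u2 t k - bs k) = Hs_norm r (fun k => bs k - u2 t k).
  rewrite /Hs_norm -Hs_sqN; congr (Num.sqrt (fine (Hs_sq _ _))).
  by apply/funext => k; rewrite opprB.
apply: le_trans le1 _.
have -> : Hs_norm s (fun k => bs k - (bs k + ph k)) = Hs_norm s ph.
  rewrite /Hs_norm -[in RHS]Hs_sqN; congr (Num.sqrt (fine (Hs_sq _ _))).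
  by apply/funext => k; rewrite opprD addNKr.
by rewrite Hs_norm_wave_real ?(ltW e0)// ler_wpM2r// mulr_ge0 ?Hs_norm_ge0 ?ltW.
Qed.

Definition line_symbol (k' : 'rV[int]_n) (i : int) : R :=
  m (ptZ k' (i * a%:Z)) 0 ord_max.

(** [line_al] and [line_be] couple the mode (k', i a) to the sites i - 1 and i + 1. The subtracted
    term in [line_be] is the transport by the symbol at -a e_d; it does not depend on i because
    m_d(-a e_d) = 0. *)
Definition line_al k' i := a%:R / 2 * line_symbol k' (i - 1).
Definition line_be k' i :=
  a%:R / 2 * line_symbol k' (i + 1) - 2^-1 * dotRZ (m (- ae)) (ptZ k' 0).

(** Sites i >= 1 are dominated by i = 1 through monotonicity; sites i <= -1 are carried by evenness
    to positive sites of the line through -k'. *)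
Lemma line_symbol_bounded k' : k' != 0 ->
  exists M, forall i, 0 < line_symbol k' i <= M.
Proof.
have pos_le (l : 'rV[int]_n) (N : nat) : l != 0 ->
    line_symbol l N.+1 <= line_symbol l 1.
  move=> l0; elim: N => // N IH; apply: le_trans IH.
  by have := m_decr l0 (ltn0Sn N); rewrite !PoszM => /ltW.
move=> k0; have Nk0 : - k' != 0 by rewrite oppr_eq0.
have pos i : 0 < line_symbol k' i by exact: m_pos.
have pos' : 0 < line_symbol (- k') 1 by exact: m_pos.
exists (line_symbol k' 0 + line_symbol k' 1 + line_symbol (- k') 1) => i.
rewrite pos /=; have := pos 0; have := pos 1.
case: i => [[|N]|N].
- lra.
- have := pos_le k' N k0; lra.
- have -> : line_symbol k' (Negz N) = line_symbol (- k') N.+1.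
    by rewrite /line_symbol -m_even ptZN NegzE mulNr opprK.
  have := pos_le _ N Nk0; lra.
Qed.

Lemma dot_mNae k' c : dotRZ (m (- ae)) (ptZ k' c) = dotRZ (m (- ae)) (ptZ k' 0).
Proof. by rewrite !dotRZ_ptZ m_Nae !mul0r. Qed.

(** The linearization shifts frequencies only by a e_d or -a e_d, so it preserves the line of modes
    (k', i a). Other modes enter only through the quadratic term, a forcing bounded by [quad_const]
    times B^2. *)
Lemma line_taylor T th0 u k' M B : k' != 0 ->
  (forall i, 0 < line_symbol k' i <= M) ->
  is_solution m r T (fun k => bs k + th0 k) u ->
  (forall t, 0 <= t <= T -> Hs_norm r (fun k => u t k - bs k) <= B) ->
  forall P t i, 0 <= t <= T ->
  `|complex.Re (u t (ptZ k' (i * a%:Z)) - bs (ptZ k' (i * a%:Z)))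
    - (taylor (line_al k') (line_be k')
         (fun j => complex.Re (th0 (ptZ k' (j * a%:Z)))) P i).[t]|
  <= (remainder (a%:R * M + `|dotRZ (m (- ae)) (ptZ k' 0)|) B
        (quad_const C r * B ^+ 2) P).[t].
Proof.
move=> k0 symM [_ uH _ _ ui] uB P t i tT.
have bsH : in_Hs r bs by apply: in_Hs_wave; exact: ae_neq0.
have dH x : 0 <= x <= T -> (Hs_sq r (fun k => (u x k - bs k)%R) < +oo)%E.
  by move=> /uH ux; have [] := in_HsB ux bsH.
have r_ge0 : 0 <= r by exact: le_trans r1.
pose F i x := - complex.Re (nl m (u x) (ptZ k' (i * a%:Z))).
pose y x j := complex.Re (u x (ptZ k' (j * a%:Z)) - bs (ptZ k' (j * a%:Z))).
apply: (@picard _ (line_al k') (line_be k') _ _ _ T y _ F _ _ _ _ P t i) => //.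
- move=> j; have /andP[p1 q1] := symM (j - 1); have /andP[p2 q2] := symM (j + 1).
  have [A [A0 AE aE]] : exists A : R, [/\ 0 <= A, a%:R / 2 = A & a%:R = A + A].
    by exists (a%:R / 2); rewrite divr_ge0//; split=> //; field.
  rewrite /line_al /line_be AE aE.
  apply: le_trans (lerD (lexx _) (ler_normB _ _)) _.
  rewrite !normrM (ger0_norm A0) (gtr0_norm p1) (gtr0_norm p2).
  rewrite (@gtr0_norm _ 2^-1) ?invr_gt0//.
  have := ler_wpM2l A0 q1; have := ler_wpM2l A0 q2.
  have := normr_ge0 (dotRZ (m (- ae)) (ptZ k' 0)); lra.
- move=> x j xT; apply: le_trans (uB x xT).
  exact: (Re_le_Hs (f := fun k => u x k - bs k) _ r_ge0 (dH x xT)).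
- move=> x j xT; rewrite /y; have [[intRe _] ->] := ui x (ptZ k' (j * a%:Z)) xT.
  split.
    have -> : EFin \o F j = (fun z => - (EFin \o
       (fun x => complex.Re (nl m (u x) (ptZ k' (j * a%:Z))))) z)%E by [].
    exact: integrableN.
  rewrite /F.
  have -> : Rintegral mu `[0, x]
      (fun x => - complex.Re (nl m (u x) (ptZ k' (j * a%:Z)))) =
    - Rintegral mu `[0, x]
      (fun x => complex.Re (nl m (u x) (ptZ k' (j * a%:Z)))).
    rewrite -mulN1r -RintegralZl//; congr Rintegral.
    by apply/funext => z; rewrite mulN1r.
  rewrite addrAC [bs _ + _]addrC addrK.
  by case: (th0 _) => p q /=.
- move=> x j xT.
  pose d k := u x k - bs k.
  have ud : u x = (fun k => bs k + d k) by apply/funext => k; rewrite /d addrC subrK.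
  have := rsum_bil_le r0r r1 m_growth (ptZ k' (j * a%:Z)) (dH x xT).
  rewrite -/d => qle; rewrite /F ud.
  rewrite (Re_nl_base_add r0r r1 m_growth a_gt0 m_ae m_Nae)//; last exact: dH.
  have -> : ptZ k' (j * a%:Z) - ae = ptZ k' ((j - 1) * a%:Z).
    by rewrite ptZN ptZD subr0 mulrBl mul1r.
  have -> : ptZ k' (j * a%:Z) + ae = ptZ k' ((j + 1) * a%:Z).
    by rewrite ptZD addr0 mulrDl mul1r.
  rewrite dot_mNae.
  rewrite /tridiag /line_al /line_be /line_symbol /y -!/(d _).
  rewrite (_ : _ - _ = - rsum (bil m d d (ptZ k' (j * a%:Z)))); last by ring.
  rewrite normrN. apply: le_trans qle _.
  rewrite ler_wpM2l ?quad_const_ge0// ler_sqr ?nnegrE ?Hs_norm_ge0 ?uB//.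
  exact: le_trans (Hs_norm_ge0 _ _) (uB x xT).
Qed.

Lemma Re_wave_line (k' : 'rV[int]_n) (e : R) j : k' != 0 ->
  complex.Re (wave (ptZ k' a%:Z) (Complex e 0) (ptZ k' (j * a%:Z))) =
    if j == 1 then e else 0.
Proof.
move=> k0; rewrite /wave eq_ptZ eqxx /= ptZN eq_ptZ [k' == _]eq_sym eqN_rV// andFb.
have -> : (j * a%:Z == a%:Z) = (j == 1).
  by rewrite -{2}[a%:Z]mul1r; apply: (inj_eq (mulIf _)); case: (a) a_gt0.
by case: ifP.
Qed.

Lemma Re_wave_opp_line (k' : 'rV[int]_n) (e : R) j : k' != 0 ->
  complex.Re (wave (ptZ k' a%:Z) (Complex e 0) (ptZ (- k') (j * a%:Z))) =
    if j == -1 then e else 0.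
Proof.
move=> k0; rewrite /wave eq_ptZ eqN_rV// andFb ptZN eq_ptZ eqxx /=.
have -> : (j * a%:Z == - a%:Z) = (j == -1).
  by rewrite -[- a%:Z]mulN1r; apply: (inj_eq (mulIf _)); case: (a) a_gt0.
by case: ifP.
Qed.

(* Only the last component of m is assumed even, so a priori m(-a e_d) may be a
   nonzero vector, which adds a transport term to the linearization.  That term
   would destroy the hermitian symmetry of d: it makes the first-order parts at
   (k', 0) and (-k', 0) differ. *)
Lemma background_transport0 (T K : R) (k' : 'rV[int]_n) :
  0 < T -> 0 < K -> controlled_growth T K -> k' != 0 ->
  dotRZ (m (- ae)) (ptZ k' 0) = 0.
Proof.
move=> T0 K0 grow k0; have Nk0 : - k' != 0 by rewrite oppr_eq0.
apply/eqP; apply: contraT => b0.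
set b := dotRZ _ _ in b0.
have b_gt0 : 0 < `|b| / 8 by rewrite divr_gt0 ?normr_gt0.
have [M1 sym1] := line_symbol_bounded k0.
have [M2 sym2] := line_symbol_bounded Nk0.
have p0 : ptZ k' a%:Z != 0 by rewrite ptZ_eq0 negb_and k0.
have [e0 e0_gt0 egrow] := grow _ p0.
set H := Hs_norm s (wave (ptZ k' a%:Z) (Complex 1 0)) in egrow.
have H0 : 0 <= H by exact: Hs_norm_ge0.
pose L1 := a%:R * M1 + `|b|.
pose L2 := a%:R * M2 + `|dotRZ (m (- ae)) (ptZ (- k') 0)|.
have L10 : 0 <= L1.
  have /andP[/ltW x y] := sym1 0.
  by rewrite addr_ge0 ?mulr_ge0 ?normr_ge0// (le_trans x y).
have L20 : 0 <= L2.
  have /andP[/ltW x y] := sym2 0.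
  by rewrite addr_ge0 ?mulr_ge0 ?normr_ge0// (le_trans x y).
set Q := quad_const C r.
have Q0 : 0 <= Q by exact: quad_const_ge0.
(* First t, then e: after division by e t, the second-order Picard errors and the quadratic errors
   of both expansions are each at most |b| / 8 in total. *)
have [|t /andP[t0 tT] tsmall] := @small_factor _
    (K * H * (L1 ^+ 2 + L2 ^+ 2) / 2) _ T _ b_gt0 T0.
  by rewrite divr_ge0// mulr_ge0 ?addr_ge0 ?sqr_ge0 ?mulr_ge0 ?(ltW K0).
have [|e /andP[e_gt0 ee0] esmall] := @small_factor _
    (Q * (K * H) ^+ 2 * (2 + (L1 + L2) * t / 2)) _ e0 _ b_gt0 e0_gt0.
  apply: mulr_ge0; first by rewrite mulr_ge0 ?sqr_ge0.
  apply: addr_ge0 => //; apply: divr_ge0 => //.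
  by apply: mulr_ge0; [exact: addr_ge0|exact: ltW].
have [|u solu ugrow] := egrow e; first by rewrite e_gt0.
have tT' : 0 <= t <= T by rewrite (ltW t0).
have tay1 := @line_taylor T _ u k' M1 _ k0 sym1 solu ugrow 2 t 0 tT'.
have tay2 := @line_taylor T _ u (- k') M2 _ Nk0 sym2 solu ugrow 2 t 0 tT'.
have [uH] : in_Hs r (fun k => u t k - bs k).
  apply: in_HsB; first by have [_ uH _ _ _] := solu; exact: uH.
  by apply: in_Hs_wave; exact: ae_neq0.
(* The modes (k', 0) and (-k', 0) are conjugate, so one real part has two first-order expansions,
   whose slopes differ by e b / 2. *)
have := uH (ptZ k' 0); rewrite ptZN oppr0 => /(congr1 (@complex.Re R)) herm _.
have ReJ (z : R[i]) : complex.Re (conjc z) = complex.Re z by case: z.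
have symE : line_symbol (- k') (-1) = line_symbol k' 1.
  by rewrite /line_symbol -m_even ptZN opprK mulN1r mul1r opprK.
move: tay1; rewrite taylor2 /tridiag /= !Re_wave_line//= !mulr0 !add0r mul0r.
rewrite /line_be add0r -/b !horner_remainder -/L1 remainder_tail2 => tay1.
move: tay2; rewrite taylor2 /tridiag /= !Re_wave_opp_line//= !mulr0 !add0r addr0.
rewrite mul0r.
rewrite /line_al add0r symE horner_remainder -/L2 remainder_tail2 herm ReJ => tay2.
move: tay1 tay2; rewrite -/Q (_ : 2`! = 2%N)//.
set X := complex.Re _; set S := a%:R / 2 * line_symbol k' 1 => tay1 tay2.
have et0 : 0 < e * t by rewrite mulr_gt0.
have : (e * t) * (2^-1 * `|b|) <= (e * t) * (`|b| / 8 + `|b| / 8).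
  have -> : (e * t) * (2^-1 * `|b|) =
      `|X - (S - 2^-1 * b) * e * t - (X - S * e * t)|.
    have -> : X - (S - 2^-1 * b) * e * t - (X - S * e * t) = (e * t) * (2^-1 * b).
      by ring.
    by rewrite !normrM (gtr0_norm e_gt0) (gtr0_norm t0) gtr0_norm ?invr_gt0.
  apply: le_trans (ler_normB _ _) (le_trans (lerD tay1 tay2) _).
  apply: le_trans (ler_wpM2l (ltW et0) (lerD tsmall esmall)).
  by rewrite le_eqVlt; apply/orP; left; apply/eqP; field.
rewrite ler_pM2l//; move: b_gt0; lra.
Qed.

(** The perturbation, the truncation error and the quadratic error are each at most e K H, H being
    the norm of the unit wave; this gives the factor 3, and the amplitude e cancels. *)
Lemma mode_growth (T K : R) (k' : 'rV[int]_n) (q : nat) :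
  0 < T -> 0 < K -> controlled_growth T K -> k' != 0 ->
  ((a%:R / 2) ^+ 2 * (line_symbol k' 2 * line_symbol k' 1)) ^+ q
    * (T ^+ q.*2 / q.*2`!%:R)
  <= 3 * (K * Hs_norm s (wave (ptZ k' a%:Z) (Complex 1 0))).
Proof.
move=> T0 K0 grow k0.
have b0 := background_transport0 T0 K0 grow k0.
have [M symM] := line_symbol_bounded k0.
have p0 : ptZ k' a%:Z != 0 by rewrite ptZ_eq0 negb_and k0.
have [e0 e0_gt0 egrow] := grow _ p0.
set H := Hs_norm s (wave (ptZ k' a%:Z) (Complex 1 0)) in egrow *.
have H0 : 0 <= H by exact: Hs_norm_ge0.
have KH0 : 0 <= K * H by rewrite mulr_ge0// ltW.
pose L := a%:R * M + `|dotRZ (m (- ae)) (ptZ k' 0)|.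
have L0 : 0 <= L.
  have /andP[/ltW x y] := symM 0.
  by rewrite addr_ge0 ?mulr_ge0 ?normr_ge0// (le_trans x y).
(* The order P must exceed 2q to retain the growing term; the amplitude e is chosen afterwards,
   depending on P and k'. *)
have [P qP PT1] := exp_term_le1 (L * T) q.*2.
set Q := quad_const C r.
have Q0 : 0 <= Q by exact: quad_const_ge0.
have tail0 := remainder_tail_ge0 P L0 (ltW T0).
have [|e /andP[e_gt0 ee0] esmall] := @small_factor _
    (Q * (K * H) * remainder_tail L P T) 1 e0 _ ltr01 e0_gt0.
  by rewrite mulr_ge0// mulr_ge0.
have [|u solu ugrow] := egrow e; first by rewrite e_gt0.
have TT : 0 <= T <= T by rewrite lexx ltW.
have tay := @line_taylor T _ u k' M _ k0 symM solu ugrow P T 1 TT.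
have r_ge0 : 0 <= r by exact: le_trans r1.
have a2 : 0 <= a%:R / 2 :> R by rewrite divr_ge0.
have al0 i : 0 <= line_al k' i.
  by rewrite /line_al; have /andP[/ltW x _] := symM (i - 1); exact: mulr_ge0.
have be0 i : 0 <= line_be k' i.
  (* The vanishing of the transport term is what makes this entry nonnegative. *)
  rewrite /line_be b0 mulr0 subr0.
  by have /andP[/ltW x _] := symM (i + 1); exact: mulr_ge0.
pose y0 (j : int) :=
  complex.Re (wave (ptZ k' a%:Z) (Complex e 0) (ptZ k' (j * a%:Z))).
have y00 j : 0 <= y0 j.
  by rewrite /y0 Re_wave_line//; case: ifP => // _; exact: ltW.
have low := taylor_lower_bound al0 be0 y00 (ltW T0) qP.
have [_ dfin] : in_Hs r (fun k => u T k - bs k).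
  apply: in_HsB; first by have [_ uH _ _ _] := solu; exact: uH.
  by apply: in_Hs_wave; exact: ae_neq0.
have yle := le_trans (Re_le_Hs (ptZ k' (1 * a%:Z)) r_ge0 dfin) (ugrow T TT).
have y01 : y0 1 = e by rewrite /y0 Re_wave_line.
move: tay; rewrite -/y0 -/L horner_remainder => tay.
move: low yle tay; rewrite y01; set Y := complex.Re _.
set TP := (taylor _ _ _ _ _).[_].
rewrite !ler_norml => low /andP[_ yle] /andP[tay _].
have expE : K * (e * H) * L ^+ P * (T ^+ P / P`!%:R) <= e * (K * H).
  have -> : K * (e * H) * L ^+ P * (T ^+ P / P`!%:R) =
      e * (K * H) * ((L * T) ^+ P / P`!%:R) by rewrite exprMn; ring.
  by rewrite -[leRHS]mulr1 ler_wpM2l// mulr_ge0// ltW.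
have quadE : Q * (K * (e * H)) ^+ 2 * remainder_tail L P T <= e * (K * H).
  have -> : Q * (K * (e * H)) ^+ 2 * remainder_tail L P T =
    e * (K * H) * (Q * (K * H) * remainder_tail L P T * e) by ring.
  by rewrite -[leRHS]mulr1 ler_wpM2l// mulr_ge0// ltW.
have prodE : line_be k' 1 * line_al k' 2 =
    (a%:R / 2) ^+ 2 * (line_symbol k' 2 * line_symbol k' 1).
  rewrite /line_be /line_al b0 mulr0 subr0 (_ : 1 + 1 = 2 :> int)//.
  by rewrite (_ : 2 - 1 = 1 :> int)//; ring.
rewrite -(ler_pM2l e_gt0); move: low; rewrite prodE; set G := _ ^+ q.
set Z := T ^+ _ / _.
have -> : G * e * Z = e * (G * Z) by ring.
move=> low; apply: le_trans low _; move: tay yle expE quadE.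
rewrite -/Q; lra.
Qed.

End IllPosedness.

(** * Linear growth of the symbol along a coordinate axis of k' *)

Section AxisGrowth.
Context {R : realType} {n : nat}.
Variables (i0 : 'I_n) (m : Zd n -> 'rV[R]_n.+1).

Definition axis (j : nat) : 'rV[int]_n := \row_i (if i == i0 then j%:Z else 0).

Lemma normZ_axis j : normZ R (axis j) = j%:R.
Proof.
rewrite /normZ (bigD1 i0)//= mxE eqxx big1 ?addr0 => [|i /negPf ii0].
  by rewrite sqrtr_sqr ger0_norm.
by rewrite mxE ii0 expr0n.
Qed.

Lemma axis_neq0 j : (0 < j)%N -> axis j != 0.
Proof.
move=> j0; apply/eqP => /matrixP /(_ 0 i0); rewrite !mxE eqxx.
by case: j j0.
Qed.

Lemma axis_linear_growth (c : int) :
  rational_fun (fun k : Zd n => m k 0 ord_max) ->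
  (forall M : R, exists B : R, forall k' : 'rV[int]_n, B <= normZ R k' ->
    M <= m (ptZ k' c) 0 ord_max) ->
  exists2 g, 0 < g & exists J, forall j, (J <= j)%N ->
    g * j%:R <= m (ptZ (axis j) c) 0 ord_max.
Proof.
move=> [N [P [Q mPQ]]] minf.
have agree j i : i != lift ord_max i0 -> ptZ (axis j) c 0 i = ptZ 0 c 0 i.
  move=> ii0; rewrite !mxE; case: unliftP => // l il.
  rewrite !mxE; case: eqVneq => // li0.
  by rewrite il li0 eqxx in ii0.
have [p pE] := horner_polyZ_line (lift ord_max i0) (ptZ 0 c) P.
have [q qE] := horner_polyZ_line (lift ord_max i0) (ptZ 0 c) Q.
apply: (@rational_linear_growth _ p q) => [j j0|M].
  have k0 : ptZ (axis j) c != 0 by rewrite ptZ_eq0 negb_and axis_neq0.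
  have [] := mPQ _ k0.
  by rewrite (pE _ (agree j)) (qE _ (agree j)) ptZ_lift mxE eqxx.
have [B Bm] := minf M; exists (Num.truncn B).+1 => j jB.
apply: Bm; rewrite normZ_axis; apply: le_trans (ltW (truncnS_gt B)) _.
by rewrite ler_nat.
Qed.

End AxisGrowth.

(** * Contradiction at high frequency *)

Unset Implicit Arguments.
Set Strict Implicit.

(* d = n.+1; m_d k = m k 0 ord_max; (k', c) = ptZ k' c *)
Theorem theorem2p6 (R : realType) (n : nat) (hn : (1 <= n)%N)
  (m : Zd n -> 'rV[R]_n.+1) (a : nat) (ha : (0 < a)%N)
  (r0 C : R) (hr0 : 0 <= r0) (hC : 0 < C)
  (hdiv : forall k : Zd n, dotRZ (m k) k = 0)
  (h1 : m (ptZ 0 a%:Z) = 0)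
  (h2rat : rational_fun (fun k : Zd n => m k 0 ord_max))
  (h2pos : forall (k' : 'rV[int]_n) (c : int), k' != 0 ->
             0 < m (ptZ k' c) 0 ord_max)
  (h2even : forall k : Zd n, m (- k) 0 ord_max = m k 0 ord_max)
  (h3 : forall N : nat, (0 < N)%N -> forall M : R, exists B : R,
          forall k' : 'rV[int]_n, B <= normZ R k' ->
            M <= m (ptZ k' (N * a)%:Z) 0 ord_max)
  (h4 : forall k' : 'rV[int]_n,
          (fun N : nat => m (ptZ k' (N * a)%:Z) 0 ord_max) @ \oo --> (0 : R))
  (h5 : forall (k' : 'rV[int]_n) (N : nat), k' != 0 -> (0 < N)%N ->
          m (ptZ k' (N.+1 * a)%:Z) 0 ord_max < m (ptZ k' (N * a)%:Z) 0 ord_max)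
  (h6 : forall k : Zd n, normRv (m k) <= C * powR (1 + normZ R k) r0) :
  forall r s : R, Num.max 2 r0 < r -> r + 1 <= s -> ~ lip_wellposed m r s.
Proof.
move=> r s; rewrite gt_max => /andP[r2 r0r] rs wp.
have r1 : 1 <= r by lra.
have [T [K [T0 K0 grow]]] := perturbed_solution ha h1 h2even wp.
have i0 : 'I_n by exact: Ordinal hn.
have [c1 c10 [J1 low1]] := axis_linear_growth i0 h2rat (h3 1%N isT).
have [c2 c20 [J2 low2]] := axis_linear_growth i0 h2rat (h3 2%N isT).
(* With q = S >= s, the mode grows like j^(2S), while the H^s norm of the unit wave is at most of
   order j^S. *)
pose S := (Num.truncn s).+1.
have sS : s <= S%:R by exact/ltW/truncnS_gt.
pose D := (a%:R / 2) ^+ 2 * (c2 * c1).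
have D0 : 0 < D by rewrite mulr_gt0 ?(mulr_gt0 c20)// exprn_gt0// divr_gt0 ?ltr0n.
pose g := D ^+ S * (T ^+ S.*2 / S.*2`!%:R).
have g0 : 0 < g.
  by rewrite mulr_gt0 ?exprn_gt0// divr_gt0 ?exprn_gt0// ltr0n fact_gt0.
(* Squaring g j^(2S) <= 3 K H and inserting H^2 <= 2 (2 + a^2)^S j^(2S) gives g^2 j^(2S) <= G, which
   fails once j > G / g^2. *)
pose G := 18 * K ^+ 2 * (2 + a%:R ^+ 2) ^+ S.
pose j := (J1 + J2 + Num.truncn (G / g ^+ 2)).+1.
have j0 : (0 < j)%N by [].
have j1 : 1 <= j%:R :> R by rewrite ler1n.
have jG : G / g ^+ 2 < j%:R.
  by apply: lt_le_trans (truncnS_gt _) _; rewrite ler_nat ltnS leq_addl.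
have {}low1 : c1 * j%:R <= line_symbol m a (axis i0 j) 1.
  by apply: low1; rewrite leqW// -addnA leq_addr.
have {}low2 : c2 * j%:R <= line_symbol m a (axis i0 j) 2.
  by apply: low2; rewrite leqW// addnAC leq_addl.
have k0 := axis_neq0 i0 j0.
have p0 : ptZ (axis i0 j) a%:Z != 0 by rewrite ptZ_eq0 negb_and k0.
have := mode_growth ha (ltW r0r) r1 h1 h2even h6 h2pos h5 S T0 K0 grow k0.
set H := Hs_norm s _ => upper.
have H0 : 0 <= H by exact: Hs_norm_ge0.
have HS : H ^+ 2 <= 2 * ((2 + a%:R ^+ 2) ^+ S * (j%:R ^+ 2) ^+ S).
  rewrite Hs_norm_wave// ler_wpM2l// /sqmodC /= expr1n expr0n addr0 mulr1.
  rewrite /weight -exprMn.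
  apply: (@le_trans _ _ (powR (1 + normZ R (ptZ (axis i0 j) a%:Z) ^+ 2) S%:R)).
    by rewrite ler_powR// lerDl sqr_ge0.
  rewrite powR_mulrn ?addr_ge0 ?sqr_ge0// lerXn2r ?nnegrE ?addr_ge0 ?sqr_ge0//.
  rewrite normZ_sqr_ptZ normZ_axis.
  have j2 : 1 <= j%:R ^+ 2 :> R by rewrite exprn_ege1.
  (* Since j >= 1, 1 + j^2 + a^2 <= (2 + a^2) j^2. *)
  have := sqr_ge0 (a%:R : R); nra.
have gj : g * (j%:R ^+ 2) ^+ S <= 3 * (K * H).
  apply: le_trans upper.
  have -> : g * (j%:R ^+ 2) ^+ S =
      (D * j%:R ^+ 2) ^+ S * (T ^+ S.*2 / S.*2`!%:R).
    by rewrite /g [(D * _) ^+ S]exprMn mulrAC.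
  rewrite ler_wpM2r//.
    by rewrite divr_ge0// exprn_ge0// ltW.
  rewrite lerXn2r ?nnegrE//.
  - by rewrite mulr_ge0 ?sqr_ge0// ltW.
  - by rewrite mulr_ge0 ?sqr_ge0// mulr_ge0// ltW// h2pos.
  rewrite /D -mulrA ler_wpM2l ?sqr_ge0// expr2 mulrACA.
  by rewrite ler_pM// mulr_ge0// ltW.
have jS : j%:R <= (j%:R ^+ 2) ^+ S :> R.
  by rewrite -exprM -[leLHS]expr1 ler_weXn2l.
have q0 : 0 < (j%:R ^+ 2) ^+ S :> R by rewrite exprn_gt0// exprn_gt0// ltr0n.
have : g ^+ 2 * (j%:R ^+ 2) ^+ S * (j%:R ^+ 2) ^+ S <= G * (j%:R ^+ 2) ^+ S.
  have -> : g ^+ 2 * (j%:R ^+ 2) ^+ S * (j%:R ^+ 2) ^+ S =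
      (g * (j%:R ^+ 2) ^+ S) ^+ 2 by ring.
  apply: (@le_trans _ _ ((3 * (K * H)) ^+ 2)).
    have gj0 : 0 <= g * (j%:R ^+ 2) ^+ S by apply/ltW/mulr_gt0.
    by rewrite lerXn2r// nnegrE ?gj0// (le_trans gj0 gj).
  have -> : (3 * (K * H)) ^+ 2 = 9 * K ^+ 2 * H ^+ 2 by ring.
  apply: le_trans (ler_wpM2l _ HS) _; first by rewrite mulr_ge0 ?sqr_ge0.
  by rewrite le_eqVlt; apply/orP; left; apply/eqP; rewrite /G; ring.
rewrite ler_pM2r// mulrC -ler_pdivlMr ?exprn_gt0// => le_jG.
by have := lt_le_trans jG (le_trans jS le_jG); rewrite ltxx.
Qed.
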